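(* Let $T=0.21$, let $w\ge T$ be the unique solution of $I_w(T)=\sqrt{T/2}$, and define $\chi:[0,1]\to[0,\infty)$ by $$\chi(a)=\begin{cases} I_w(a)^2, & a\in[0,T],\\ a/2, & a\in(T,1/2],\end{cases}\qquad \chi(a)=\chi(1-a)\ \text{ for } a\in(1/2,1].$$ Then for every dyadic rational $a\in[0,1/2]$, $$W(a)\le\max_{\beta\in[0,a]}\min\left\{\frac14\left(\sqrt{\chi(a+\beta)}+\sqrt{\chi(a-\beta)}\right)^2+\beta^2,\ \frac14\left(\sqrt{4\left(\frac12-\frac1{\sqrt{2\pi}}\right)\beta+\frac1{2\pi}}+\frac1{\sqrt{2\pi}}\right)^2\right\}.$$
   Context: For $f:\{\pm1\}^n\to\{0,1\}$ and $i\in\{1,\dots,n\}$, let $\hat f_i=\mathbb{E}[f(\mathbf X)X_i]$ with $\mathbf X$ uniform on $\{\pm1\}^n$, and let $\mathbf W_1[f]=\sum_{i=1}^n\hat f_i^2$ be the level-1 Fourier weight. For $a\in\{0,2^{-n},2\cdot2^{-n},\dots,1\}$, $W^{(n)}(a)$ is the maximum of $\mathbf W_1[f]$ over all $f:\{\pm1\}^n\to\{0,1\}$ with $\mathbb{E}f(\mathbf X)=a$. For a dyadic rational $a\in[0,1]$, $W(a)=\sup W^{(n)}(a)$, the supremum being over all $n\ge1$ with $2^na\in\mathbb{Z}$. Let $\phi$ and $\Phi$ be the standard Gaussian density and cumulative distribution function, and $I(t)=\phi(\Phi^{-1}(t))$ for $t\in(0,1)$, $I(0)=I(1)=0$ (the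 Gaussian isoperimetric profile). For $w>0$ and $0\le a\le w$, $I_w(a)=w\,I(a/w)$. *)

(* Defs.v *)
From mathcomp Require Import all_boot all_order all_algebra.
From mathcomp Require Import all_classical all_reals all_analysis.

Set Implicit Arguments.
Unset Strict Implicit.
Unset Printing Implicit Defensive.

Import Order.TTheory GRing.Theory Num.Theory.

Local Open Scope classical_set_scope.
Local Open Scope ring_scope.

(* The cube {+1,-1}^n is encoded by bits: the bit b stands for (-1)^b. *)
Definition cube (n : nat) := {ffun 'I_n -> bool}.

Definition coordinate {R : realType} {n : nat} (i : 'I_n) (x : cube n) : R :=
  (-1) ^+ x i.

Definition mean {R : realType} {n : nat} (g : cube n -> R) : R :=
  (\sum_(x : cube n) g x) / #|{: cube n}|%:R.

Definition fourier1 {R : realType} {n : nat} (f : {ffun cube n -> bool})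
    (i : 'I_n) : R :=
  mean (fun x => (f x)%:R * coordinate i x).

Definition level1_weight {R : realType} {n : nat} (f : {ffun cube n -> bool})
    : R :=
  \sum_(i < n) fourier1 f i ^+ 2.

(* Weights are nonnegative, so the default value 0 does not affect the maximum
   when 2^n a is an integer in [0, 2^n], i.e. when some f has mean a. *)
Definition Wn {R : realType} (n : nat) (a : R) : R :=
  \big[Num.max/0]_(f : {ffun cube n -> bool} | mean (fun x => (f x)%:R) == a)
    level1_weight f.

Definition dyadic {R : realType} (a : R) : Prop :=
  exists n : nat, 2 ^+ n * a \is a Num.int.

(* For a dyadic in [0, 1] the set is nonempty and, by Parseval, bounded by 1,
   so that sup is the genuine least upper bound. *)
Definition W {R : realType} (a : R) : R :=
  sup [set Wn n a | n in [set n : nat | (1 <= n)%N /\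
                                        2 ^+ n * a \is a Num.int]].

Definition gauss_pdf {R : realType} (x : R) : R := normal_pdf 0 1 x.

Definition gauss_cdf {R : realType} (x : R) : R :=
  fine (normal_prob (0 : R) 1 `]-oo, x]).

(* gauss_cdf is a bijection from R to ]0, 1[; its inverse is only used there. *)
Definition gauss_quantile {R : realType} : R -> R := 'pinv_(fun=> 0) setT gauss_cdf.

Definition gauss_profile {R : realType} (t : R) : R :=
  if 0 < t < 1 then gauss_pdf (gauss_quantile t) else 0.

(* I_w(a) = w I(a/w), meant for 0 < w and 0 <= a <= w. *)
Definition scaled_profile {R : realType} (w a : R) : R :=
  w * gauss_profile (a / w).

Definition T0 {R : realType} : R := 21 / 100.

Definition chi_low {R : realType} (w a : R) : R :=
  if a <= T0 then scaled_profile w a ^+ 2 else a / 2.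

(* Meant for 0 <= a <= 1. *)
Definition chi {R : realType} (w a : R) : R :=
  if a <= 1 / 2 then chi_low w a else chi_low w (1 - a).

Definition is_maximum {R : realType} (A : set R) (M : R) : Prop :=
  A M /\ ubound A M.

(* Main.v *)
Require Import Defs.
From Stdlib Require Import ZArith.
From mathcomp Require Import all_boot all_order all_algebra.
From mathcomp Require Import all_classical all_reals all_analysis.
From mathcomp Require Import ring lra ssrZ.

(** Write [b] for a degree-one coefficient of [f] and [a] for its mean. The two
restrictions of [f] along that coordinate have means [a + b] and [a - b], and
Minkowski's inequality bounds the level-1 weight of [f] by [b^2] plus the square
of half the sum of the square roots of their weights. The function [I_w] solves
the resulting recursion: [b^2 + ((I_w(a+b) + I_w(a-b)) / 2)^2 <= I_w(a)^2],
because for the Gaussian profile the left side decreases in [b >= 0] as long as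
the quantile of [a/w] is at most [-1]. Induction on the dimension then bounds
the weight by [I_w(a)^2] for [a <= T]; restrictions with mean in [[T, 2T]] are
handled by the general bound [a/2], which is at most [I_w(a)^2] there by the
choice of [w]. Passing to the complement bounds the weight by [chi], and one more
restriction gives the first term of the minimum.

For the second term, let [l] be the linear part of [f]. Its squared norm, the
weight of [f], is the mean of [f l] and so at most half the mean of [|l|]. A
Khinchine inequality with remainder bounds the latter: for a unit vector [u] whose
largest entry in absolute value is [M],
  [E |sum u_j X_j| <= sqrt (2/pi) + (1 - sqrt (2/pi)) M].
If [M] is small this follows by Lindeberg replacement
started from [E |x + s G|]; if [M] is large, by averaging over the sign of the
largest entry; in between, by majorising [|x|] by a quadratic polynomial minus
cosines, the mean of which is explicit. Both terms are used with the largest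
degree-one coefficient of [f]. *)

Set Implicit Arguments.
Unset Strict Implicit.
Unset Printing Implicit Defensive.

Import Order.TTheory GRing.Theory Num.Theory.
Import numFieldNormedType.Exports.

Local Open Scope classical_set_scope.
Local Open Scope ring_scope.

(** * Gaussian distribution and profile *)

Section Calculus.
Variable R : realType.
Implicit Types (f df : R -> R) (a b x : R).

Lemma is_derive_continuous f x l : is_derive x 1 f l -> {for x, continuous f}.
Proof. by case=> /derivable1_diffP/differentiable_continuous. Qed.

Lemma is_derive_MVT f df a b : a <= b ->
  (forall x, a <= x <= b -> is_derive x 1 f (df x)) ->
  exists2 c, a <= c <= b & f b - f a = df c * (b - a).
Proof.
move=> ab H; have [| |c cab E] := @MVT_segment R f df a b ab.
- by move=> x; rewrite in_itv /= => /andP[ax xb]; apply: H; rewrite !ltW.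
- apply: continuous_in_subspaceT => x /[!inE]/= xab.
  by apply: is_derive_continuous (H _ _); move: xab; rewrite in_itv.
- by exists c => //; move: cab; rewrite in_itv.
Qed.

Lemma is_derive_homo f df a b : a <= b ->
  (forall x, a <= x <= b -> is_derive x 1 f (df x)) ->
  (forall x, a <= x <= b -> 0 <= df x) -> f a <= f b.
Proof.
move=> ab H D; have [c cab E] := is_derive_MVT ab H.
by rewrite -subr_ge0 E mulr_ge0 ?D ?subr_ge0.
Qed.

Lemma is_derive_homo_lt f df a b : a < b ->
  (forall x, a <= x <= b -> is_derive x 1 f (df x)) ->
  (forall x, a <= x <= b -> 0 < df x) -> f a < f b.
Proof.
move=> ab H D; have [c cab E] := is_derive_MVT (ltW ab) H.
by rewrite -subr_gt0 E mulr_gt0 ?D ?subr_gt0.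
Qed.

Lemma is_derive_exprn x n :
  is_derive x 1 (fun t : R => t ^+ n.+1) (n.+1%:R * x ^+ n).
Proof.
rewrite (_ : (fun t : R => t ^+ n.+1) = (id : R -> R) ^+ n.+1); last first.
  by rewrite exprfctE.
by apply: is_derive_eq; rewrite scaler1.
Qed.

End Calculus.

Section Gauss.
Variable R : realType.
Implicit Types (x y z t : R).

(** The maximum of the density; [2 * peak] is the mean of [|G|] for a standard Gaussian [G]. *)
Definition peak : R := (Num.sqrt (2 * pi))^-1.

Lemma peak_gt0 : 0 < peak.
Proof. by rewrite invr_gt0 sqrtr_gt0 mulr_gt0 ?pi_gt0. Qed.

Lemma sqr_peak : peak ^+ 2 = (2 * pi)^-1.
Proof. by rewrite /peak exprVn sqr_sqrtr// mulr_ge0 ?pi_ge0. Qed.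

Lemma gauss_pdfE x : gauss_pdf x = peak * expR (- (x ^+ 2 / 2)).
Proof.
rewrite /gauss_pdf normal_pdfE ?oner_neq0// /normal_peak /normal_fun /peak.
by rewrite expr1n mul1r subr0 mulNr -mulr_natl.
Qed.

Lemma gauss_pdf_gt0 x : 0 < gauss_pdf x.
Proof. by rewrite gauss_pdfE mulr_gt0 ?peak_gt0 ?expR_gt0. Qed.

Lemma gauss_pdfN x : gauss_pdf (- x) = gauss_pdf x.
Proof. by rewrite !gauss_pdfE sqrrN. Qed.

Lemma gauss_pdf0 : gauss_pdf (0 : R) = peak.
Proof. by rewrite gauss_pdfE expr0n /= mul0r oppr0 expR0 mulr1. Qed.

Lemma gauss_pdf_le_peak x : gauss_pdf x <= peak.
Proof.
rewrite gauss_pdfE ler_piMr ?(ltW peak_gt0)// expR_le1.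
by rewrite oppr_le0 divr_ge0 ?sqr_ge0.
Qed.

Lemma ler_gauss_pdf x y : x ^+ 2 <= y ^+ 2 -> gauss_pdf y <= gauss_pdf x.
Proof.
by move=> xy; rewrite !gauss_pdfE ler_pM2l ?peak_gt0// ler_expR lerN2 ler_pM2r.
Qed.

Global Instance is_derive_gauss_pdf x :
  is_derive x 1 (@gauss_pdf R) (- x * gauss_pdf x).
Proof.
rewrite (_ : gauss_pdf = fun x => peak * expR (- (x ^+ 2 / 2))); last first.
  by apply/funext => y; exact: gauss_pdfE.
by apply: trigger_derive; rewrite /GRing.scale/=; field.
Qed.

Local Notation P := (normal_prob (0 : R) 1).

(** Viewed as a random variable, the identity has distribution function [gauss_cdf], so the general
    limits of distribution functions at infinity apply to it. *)
Definition id_real : {RV P >-> R}.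
Proof.
apply: (@mfun_Sub _ _ _ _ (idfun : measurableTypeR R -> R)).
by apply: mem_set; exact: measurable_id.
Defined.

Lemma gauss_cdf_cvgy : @gauss_cdf R x @[x --> +oo] --> (1 : R).
Proof.
have := @cvg_cdfy1 _ _ _ P id_real.
by move/fine_cvg.
Qed.

Lemma gauss_cdf_cvgNy : @gauss_cdf R x @[x --> -oo] --> (0 : R).
Proof.
have := @cvg_cdfNy0 _ _ _ P id_real.
by move/fine_cvg.
Qed.

Global Instance is_derive_gauss_cdf x :
  is_derive x 1 (@gauss_cdf R) (gauss_pdf x).
Proof.
have ci : {for x, continuous (@normal_pdf R 0 1)}.
  by apply: continuous_normal_pdf; exact: oner_neq0.
have xx1 : x < x + 1 by rewrite ltrDl.
have intx : lebesgue_measure.-integrable `]-oo, x + 1]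
    (EFin \o @normal_pdf R 0 1).
  by apply: integrableS (integrable_normal_pdf 0 1); [| exact: measurable_itv |].
have [d e] := @continuous_FTC1 R _ -oo%O x _ xx1 intx (ltNyr _) ci.
by constructor; [exact: d|rewrite -derive1E; exact: e].
Qed.


(** The sum [gauss_cdf y + gauss_cdf (- y)] has derivative 0 and tends to 1, hence is constantly
    1. *)
Lemma gauss_cdfN x : gauss_cdf (- x) = 1 - gauss_cdf x.
Proof.
pose s y : R := gauss_cdf y + gauss_cdf (- y).
have ds y : is_derive y 1 s 0.
  apply: trigger_derive; rewrite /GRing.scale/= gauss_pdfN; ring.
have s1 : s y @[y --> +oo] --> (1 : R).
  rewrite -[X in _ --> X]addr0; apply: cvgD; first exact: gauss_cdf_cvgy.
  exact: (cvgNy_compNP (@gauss_cdf R) (nbhs (0 : R))).1 gauss_cdf_cvgNy.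
have sx : s y @[y --> +oo] --> s x.
  rewrite (_ : s = fun=> s x); first exact: cvg_cst.
  by apply/funext => y; exact: is_derive_0_is_cst.
by apply/eqP; rewrite eq_sym subr_eq addrC -/(s x) (cvg_unique _ s1 sx).
Qed.

Lemma gauss_cdf0 : gauss_cdf (0 : R) = 1 / 2.
Proof. by have := gauss_cdfN 0; rewrite oppr0; lra. Qed.

Lemma ltr_gauss_cdf : {mono (@gauss_cdf R) : x y / x < y}.
Proof.
apply: leW_mono; apply: le_mono => x y xy.
exact: (is_derive_homo_lt xy (fun z _ => is_derive_gauss_cdf z)
  (fun z _ => gauss_pdf_gt0 z)).
Qed.

Lemma ler_gauss_cdf : {mono (@gauss_cdf R) : x y / x <= y}.
Proof. by move=> x y; rewrite !leNgt ltr_gauss_cdf. Qed.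

Lemma gauss_cdf_gt0 x : 0 < gauss_cdf x.
Proof.
apply: (@le_lt_trans _ _ (gauss_cdf (x - 1))).
  exact/fine_ge0/measure_ge0.
by rewrite ltr_gauss_cdf ltrBlDr ltrDl.
Qed.

Lemma gauss_cdf_lt1 x : gauss_cdf x < 1.
Proof. by rewrite -subr_gt0 -gauss_cdfN gauss_cdf_gt0. Qed.

Lemma gauss_cdf_surj t : 0 < t < 1 -> exists x, gauss_cdf x = t.
Proof.
move=> /andP[t0 t1].
have [a /= at_] : exists a, gauss_cdf a < t.
  near (-oo : set_system R) => a; exists a.
  by near: a; exact: cvgr_lt gauss_cdf_cvgNy _ t0.
have [b /= bt] : exists b, t < gauss_cdf b.
  near (+oo : set_system R) => b; exists b.
  by near: b; exact: cvgr_gt gauss_cdf_cvgy _ t1.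
have ab : a <= b by rewrite -ler_gauss_cdf ltW// (lt_trans at_).
have [||c _ <-] := @IVT R (@gauss_cdf R) a b t ab; last by exists c.
  apply: continuous_in_subspaceT => x _.
  exact: is_derive_continuous (is_derive_gauss_cdf x).
by rewrite ge_min le_max (ltW at_) (ltW bt) orbT.
Unshelve. all: by end_near. Qed.

Lemma gauss_cdfK : cancel (@gauss_cdf R) gauss_quantile.
Proof.
move=> x; apply: pinvKV; rewrite ?inE// => y z _ _.
exact: (inc_inj ler_gauss_cdf).
Qed.

Lemma gauss_quantileK t : 0 < t < 1 -> gauss_cdf (gauss_quantile t) = t.
Proof. by move=> /gauss_cdf_surj[x <-]; rewrite gauss_cdfK. Qed.

Lemma ltr_gauss_quantile t u : 0 < t < 1 -> 0 < u < 1 ->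
  (gauss_quantile t < gauss_quantile u) = (t < u).
Proof.
by move=> t01 u01; rewrite -ltr_gauss_cdf !gauss_quantileK.
Qed.

Lemma ler_gauss_quantile t u : 0 < t < 1 -> 0 < u < 1 ->
  (gauss_quantile t <= gauss_quantile u) = (t <= u).
Proof. by move=> t01 u01; rewrite !leNgt ltr_gauss_quantile. Qed.

Lemma is_derive_gauss_quantile t : 0 < t < 1 ->
  is_derive t 1 (@gauss_quantile R) (gauss_pdf (gauss_quantile t))^-1.
Proof.
move=> /gauss_cdf_surj[x <-]; rewrite gauss_cdfK.
apply: is_derive_inverse.
- by apply: filterE => y; exact: gauss_cdfK.
- by apply: filterE => y; exact: is_derive_continuous (is_derive_gauss_cdf y).
- by rewrite gt_eqF ?gauss_pdf_gt0.
Qed.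

Lemma gauss_profileE t : 0 < t < 1 ->
  gauss_profile t = gauss_pdf (gauss_quantile t) :> R.
Proof. by rewrite /gauss_profile => ->. Qed.

Lemma gauss_profile_cdf x : gauss_profile (gauss_cdf x) = gauss_pdf x.
Proof. by rewrite gauss_profileE ?gauss_cdfK// gauss_cdf_gt0 gauss_cdf_lt1. Qed.

Lemma gauss_profile_ge0 t : 0 <= gauss_profile t :> R.
Proof. by rewrite /gauss_profile; case: ifP => // _; exact/ltW/gauss_pdf_gt0. Qed.

Lemma gauss_profile_gt0 t : 0 < t < 1 -> 0 < gauss_profile t :> R.
Proof. by move=> t01; rewrite gauss_profileE// gauss_pdf_gt0. Qed.

Lemma near_unit_interval t : 0 < t < 1 -> \forall u \near t, 0 < u < 1.
Proof.
move=> /andP[t0 t1]; near=> u; apply/andP; split; near: u.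
- exact: lt_nbhsr.
- exact: lt_nbhsl.
Unshelve. all: by end_near. Qed.

Lemma is_derive_gauss_profile t : 0 < t < 1 ->
  is_derive t 1 (@gauss_profile R) (- gauss_quantile t).
Proof.
move=> t01.
have dq := is_derive_gauss_quantile t01.
apply: (@near_eq_is_derive _ _ _ (@gauss_pdf R \o gauss_quantile)).
- by near=> u; rewrite gauss_profileE//; near: u; exact: near_unit_interval.
- apply: trigger_derive; rewrite /GRing.scale/=; field.
  by rewrite gt_eqF ?gauss_pdf_gt0.
Unshelve. all: by end_near. Qed.

Lemma continuous_gauss_profile t : 0 <= t < 1 ->
  {for t, continuous (@gauss_profile R)}.
Proof.
rewrite le_eqVlt => /andP[/predU1P[<- _|t0 t1]]; last first.
  by apply: is_derive_continuous (is_derive_gauss_profile _); rewrite t0.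
apply/cvgrPdist_lt => e e0.
(* With this [u], the next choice of [x] gives [expR (x ^+ 2 / 2) >= 1 + x ^+ 2 / 2 > peak / e],
   that is, [gauss_pdf x < e]. *)
pose u := peak / e; have u0 : 0 < u by rewrite divr_gt0 ?peak_gt0.
pose x := - (u + 1).
have xe : gauss_pdf x < e.
  rewrite gauss_pdfE expRN ltr_pdivrMr ?expR_gt0// mulrC -ltr_pdivrMr// -/u.
  apply: (lt_le_trans _ (expR_ge1Dx _)).
  by rewrite /x sqrrN; have := sqr_ge0 u; rewrite !expr2; lra.
have p0 : gauss_profile 0 = 0 :> R by rewrite /gauss_profile ltxx.
near=> s; rewrite p0 sub0r normrN ger0_norm ?gauss_profile_ge0//.
rewrite /gauss_profile; case: ifPn => // s01.
apply: le_lt_trans xe; apply: ler_gauss_pdf.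
suff qx : gauss_quantile s < x.
  by move: qx; rewrite /x !expr2 => qx; nra.
rewrite -ltr_gauss_cdf gauss_quantileK//; near: s.
exact/lt_nbhsl/gauss_cdf_gt0.
Unshelve. all: by end_near. Qed.

End Gauss.

(** * A two-point inequality for the Gaussian profile *)

Section TwoPoint.
Variable R : realType.
Implicit Types (a b x y : R).
Local Notation q := (@gauss_quantile R).
Local Notation I := (@gauss_profile R).

Lemma sinh_ge y : 0 <= y -> 2 * y <= expR y - expR (- y).
Proof.
move=> y0; rewrite -subr_ge0.
pose f (t : R) : R := expR t - expR (- t) - 2 * t.
have f0 : f 0 = 0 by rewrite /f oppr0 mulr0 subrr subrr.
rewrite -/(f y) -f0.
apply: (@is_derive_homo _ f (fun t => expR t + expR (- t) - 2) _ _ y0).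
  by move=> t _; apply: trigger_derive; rewrite /GRing.scale/=; ring.
move=> t _; have e : expR t * expR (- t) = 1 := expRxMexpNx_1 t.
have -> : expR t + expR (- t) - 2 = (expR t - 1) ^+ 2 * expR (- t).
  rewrite (_ : _ * _ = expR t * (expR t * expR (- t)) -
    2 * (expR t * expR (- t)) + expR (- t)); last by ring.
  by rewrite e; ring.
by rewrite mulr_ge0 ?sqr_ge0 ?expR_ge0.
Qed.

Lemma is_derive_quantileD a x : 0 < a + x < 1 ->
  is_derive x 1 (fun y => q (a + y)) (I (a + x))^-1.
Proof.
move=> ax; have := is_derive_gauss_quantile ax; rewrite -gauss_profileE// => d.
by apply: trigger_derive; rewrite /GRing.scale/=; ring.
Qed.

Lemma is_derive_quantileB a x : 0 < a - x < 1 ->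
  is_derive x 1 (fun y => q (a - y)) (- (I (a - x))^-1).
Proof.
move=> ax; have := is_derive_gauss_quantile ax; rewrite -gauss_profileE// => d.
by apply: trigger_derive; rewrite /GRing.scale/=; ring.
Qed.

Lemma is_derive_profileD a x : 0 < a + x < 1 ->
  is_derive x 1 (fun y => I (a + y)) (- q (a + x)).
Proof.
move=> ax; have d := is_derive_gauss_profile ax.
by apply: trigger_derive; rewrite /GRing.scale/=; ring.
Qed.

Lemma is_derive_profileB a x : 0 < a - x < 1 ->
  is_derive x 1 (fun y => I (a - y)) (q (a - x)).
Proof.
move=> ax; have d := is_derive_gauss_profile ax.
by apply: trigger_derive; rewrite /GRing.scale/=; ring.
Qed.

Lemma gauss_quantile_le0 x : 0 < x <= 1 / 2 -> q x <= 0.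
Proof.
move=> /andP[x0 x1]; rewrite -ler_gauss_cdf gauss_quantileK ?gauss_cdf0//.
by rewrite x0/=; lra.
Qed.

Section FixedCentre.
Variables (a b : R).
Hypothesis (b0 : 0 <= b) (ba : b < a) (ab : a + b <= 1 / 2) (qa : q a <= -1).

Ltac slra := move: (b0) (ba) (ab) (qa) => ? ? ? ?; lra.

Let unitD x : 0 <= x <= b -> 0 < a + x < 1.
Proof. by move=> /andP[x0 xb]; apply/andP; split; slra. Qed.

Let unitB x : 0 <= x <= b -> 0 < a - x < 1.
Proof. by move=> /andP[x0 xb]; apply/andP; split; slra. Qed.

Let quantile_le x : 0 <= x <= b -> q (a - x) <= q (a + x) /\ q (a + x) <= 0.
Proof.
move=> xb; rewrite ler_gauss_quantile ?unitB ?unitD//; split; first by slra.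
by apply: gauss_quantile_le0; have /andP[-> _] := unitD xb => /=; slra.
Qed.

Let profile_le x : 0 <= x <= b -> I (a - x) <= I (a + x).
Proof.
move=> xb; rewrite !gauss_profileE ?unitB ?unitD//; apply: ler_gauss_pdf.
have [h1 h2] := quantile_le xb; rewrite !expr2; nra.
Qed.

(** The sum is [2 * q a <= -2] at [x = 0], and it decreases in [x] because its derivative is
    [1 / I (a + x) - 1 / I (a - x)]. *)
Let quantile_sum x : 0 <= x <= b -> q (a + x) + q (a - x) <= -2.
Proof.
move=> /andP[x0 xb]; pose h t := - (q (a + t) + q (a - t)).
suff : h 0 <= h x by rewrite /h addr0 subr0; slra.
apply: (@is_derive_homo _ h (fun t => - ((I (a + t))^-1 - (I (a - t))^-1))) => //.
  move=> t /andP[t0 tx]; have tb : 0 <= t <= b by rewrite t0 (le_trans tx).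
  have d1 := is_derive_quantileD (unitD tb).
  have d2 := is_derive_quantileB (unitB tb).
  by apply: trigger_derive.
move=> t /andP[t0 tx]; have tb : 0 <= t <= b by rewrite t0 (le_trans tx).
rewrite oppr_ge0 subr_le0 lef_pV2 ?posrE ?gauss_profile_gt0 ?unitB ?unitD//.
exact: profile_le.
Qed.

(* [(I_+ + I_-) (1 / I_+ + 1 / I_-) - 4 = 4 sinh^2 ((q_-^2 - q_+^2) / 4)] *)
Let profile_ratio x : 0 <= x <= b ->
  (q (a + x) - q (a - x)) ^+ 2 + 4 <=
  (I (a + x) + I (a - x)) * ((I (a + x))^-1 + (I (a - x))^-1).
Proof.
move=> xb; have [q1 q2] := quantile_le xb; have q3 := quantile_sum xb.
rewrite !gauss_profileE ?unitB ?unitD//.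
set u := q (a + x) in q1 q2 q3 *; set v := q (a - x) in q1 q2 q3 *.
pose y := (v ^+ 2 - u ^+ 2) / 4.
(* Here [q a <= -1] enters: [u + v <= -2] gives [2 * y = (u - v) * - (u + v) / 2 >= u - v]. *)
have s : u - v <= expR y - expR (- y).
  by apply: le_trans (sinh_ge _); rewrite /y !expr2; nra.
have e : expR y * expR (- y) = 1 := expRxMexpNx_1 y.
have uv : gauss_pdf u = gauss_pdf v * expR y ^+ 2.
  rewrite !gauss_pdfE -mulrA; congr (_ * _).
  by rewrite [expR y ^+ 2]expr2 -!expRD; congr expR; rewrite /y; field.
have -> : (gauss_pdf u + gauss_pdf v) * ((gauss_pdf u)^-1 + (gauss_pdf v)^-1) =
    (expR y - expR (- y)) ^+ 2 + 4.
  rewrite uv expRN; field.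
  by rewrite !gt_eqF ?gauss_pdf_gt0 ?expR_gt0.
have uv0 : 0 <= u - v by rewrite subr_ge0.
by rewrite lerD2r lerXn2r// nnegrE (le_trans uv0 s).
Qed.

(** The difference of the two sides vanishes at 0, and its derivative is half the slack in
    [profile_ratio]. *)
Let chord_ge x : 0 <= x <= b ->
  2 * x <= (I (a + x) + I (a - x)) / 2 * (q (a + x) - q (a - x)).
Proof.
move=> /andP[x0 xb]; rewrite -subr_ge0.
pose f t := (I (a + t) + I (a - t)) / 2 * (q (a + t) - q (a - t)) - 2 * t.
have f0 : f 0 = 0 by rewrite /f addr0 subr0 subrr !mulr0 subrr.
rewrite -/(f x) -f0.
apply: (@is_derive_homo _ f (fun t =>
  (I (a + t) + I (a - t)) / 2 * ((I (a + t))^-1 + (I (a - t))^-1) +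
  (q (a - t) - q (a + t)) / 2 * (q (a + t) - q (a - t)) - 2)) => //.
  move=> t /andP[t0 tx]; have tb : 0 <= t <= b by rewrite t0 (le_trans tx).
  have d1 := is_derive_quantileD (unitD tb).
  have d2 := is_derive_quantileB (unitB tb).
  have d3 := is_derive_profileD (unitD tb).
  have d4 := is_derive_profileB (unitB tb).
  apply: trigger_derive; rewrite /GRing.scale/=; field.
  by rewrite !gt_eqF ?gauss_profile_gt0 ?unitB ?unitD.
move=> t /andP[t0 tx]; have tb : 0 <= t <= b by rewrite t0 (le_trans tx).
by have := profile_ratio tb; rewrite !expr2; slra.
Qed.

(** Equality holds at [b = 0], and the derivative of the left side in [b] is minus the slack in
    [chord_ge]. *)
Lemma profile_two_point_lt :
  b ^+ 2 + ((I (a + b) + I (a - b)) / 2) ^+ 2 <= I a ^+ 2.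
Proof.
pose f t := - (t ^+ 2 + ((I (a + t) + I (a - t)) / 2) ^+ 2).
suff : f 0 <= f b.
  by rewrite /f addr0 subr0 -mulr2n -[I a *+ 2]mulr_natr mulfK ?pnatr_eq0//
    expr0n add0r lerN2.
apply: (@is_derive_homo _ f (fun t =>
  (I (a + t) + I (a - t)) / 2 * (q (a + t) - q (a - t)) - 2 * t)) => //.
  move=> t tb.
  have d3 := is_derive_profileD (unitD tb).
  have d4 := is_derive_profileB (unitB tb).
  by apply: trigger_derive; rewrite /GRing.scale/=; field.
by move=> t tb; rewrite subr_ge0 chord_ge.
Qed.

End FixedCentre.

(** The case [b = a], where the derivative of [I (a - b)] blows up, is a left limit of the case
    [b < a]; the nonnegative term [I (a - t)] is dropped first, which leaves a function continuous
    at [a]. *)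
Lemma profile_two_point a b : 0 < a -> 0 <= b <= a -> a + b <= 1 / 2 ->
  q a <= -1 -> b ^+ 2 + ((I (a + b) + I (a - b)) / 2) ^+ 2 <= I a ^+ 2.
Proof.
move=> a0 /andP[b0]; rewrite le_eqVlt => /predU1P[->|ba] ab qa; last first.
  exact: profile_two_point_lt.
rewrite subrr; have -> : I 0 = 0 by rewrite /gauss_profile ltxx.
rewrite addr0.
pose g t := t ^+ 2 + (I (a + t) / 2) ^+ 2.
have ga : g t @[t --> a^'-] --> g a.
  apply: cvg_at_left_filter.
  have d := @is_derive_profileD a a.
  have : 0 < a + a < 1 by apply/andP; split; lra.
  move=> /d {}d.
  apply: (@is_derive_continuous _ g); exact: trigger_derive.
rewrite -/(g a); apply: (cvgr_to_le ga).
near=> t.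
have t0 : 0 <= t by near: t; exact: nbhs_left_ge.
have ta : t < a by near: t; exact: nbhs_left_lt.
have at2 : a + t <= 1 / 2 by lra.
apply: le_trans (profile_two_point_lt t0 ta at2 qa).
rewrite /g lerD2l lerXn2r ?nnegrE ?divr_ge0 ?addr_ge0 ?gauss_profile_ge0//.
by rewrite ler_pM2r ?invr_gt0// lerDl gauss_profile_ge0.
Unshelve. all: by end_near. Qed.

End TwoPoint.

(** * Rademacher sums *)

Section Cube.
Variable R : realType.

Lemma card_cube n : #|{: cube n}| = (2 ^ n)%N.
Proof. by rewrite card_ffun card_bool card_ord. Qed.

Lemma card_cube_gt0 n : 0 < #|{: cube n}|%:R :> R.
Proof. by rewrite card_cube ltr0n expn_gt0. Qed.

Section Mean.
Variable n : nat.
Implicit Types F G : cube n -> R.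

Lemma mean_cst (c : R) : mean (fun _ : cube n => c) = c.
Proof.
by rewrite /mean sumr_const -[c *+ _]mulr_natr mulfK// gt_eqF ?card_cube_gt0.
Qed.

Lemma meanD F G : mean (fun x => F x + G x) = mean F + mean G.
Proof. by rewrite /mean big_split mulrDl. Qed.

Lemma meanZ (c : R) F : mean (fun x => c * F x) = c * mean F.
Proof. by rewrite /mean -mulr_sumr mulrA. Qed.

Lemma meanN F : mean (fun x => - F x) = - mean F.
Proof. by rewrite /mean sumrN mulNr. Qed.

Lemma meanB F G : mean (fun x => F x - G x) = mean F - mean G.
Proof. by rewrite meanD meanN. Qed.

Lemma mean_sum (I : finType) (F : I -> cube n -> R) :
  mean (fun x => \sum_i F i x) = \sum_i mean (F i).
Proof. by rewrite /mean exchange_big mulr_suml. Qed.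

Lemma ler_mean F G : (forall x, F x <= G x) -> mean F <= mean G.
Proof.
by move=> FG; rewrite ler_pM2r ?invr_gt0 ?card_cube_gt0//; exact: ler_sum.
Qed.

Lemma mean_ge0 F : (forall x, 0 <= F x) -> 0 <= mean F.
Proof. by move=> F0; rewrite -(mean_cst 0); exact: ler_mean. Qed.

Lemma eq_mean F G : F =1 G -> mean F = mean G.
Proof. by move=> FG; congr (_ / _); exact: eq_bigr. Qed.

Lemma mean_reindex (h : cube n -> cube n) F : injective h ->
  mean (fun x => F (h x)) = mean F.
Proof. by move=> hI; rewrite /mean [in RHS](reindex_inj hI). Qed.

End Mean.

Definition cube_cons n (i : 'I_n.+1) (b : bool) (x : cube n) : cube n.+1 :=
  [ffun j => if unlift i j is Some k then x k else b].

Lemma cube_cons_i n (i : 'I_n.+1) b (x : cube n) : cube_cons i b x i = b.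
Proof. by rewrite ffunE unlift_none. Qed.

Lemma cube_cons_lift n (i : 'I_n.+1) b (x : cube n) j :
  cube_cons i b x (lift i j) = x j.
Proof. by rewrite ffunE liftK. Qed.

Lemma sum_cube_cons n (i : 'I_n.+1) b (F : cube n.+1 -> R) :
  \sum_(x : cube n.+1 | x i == b) F x = \sum_x F (cube_cons i b x).
Proof.
rewrite (reindex_onto (cube_cons i b) (fun x : cube n.+1 => [ffun j => x (lift i j)])).
  apply: eq_bigl => x; rewrite cube_cons_i eqxx/=.
  by apply/eqP/ffunP => j; rewrite ffunE cube_cons_lift.
move=> x /eqP xi; apply/ffunP => j; rewrite ffunE.
by case: unliftP => [k ->|->]; rewrite ?ffunE.
Qed.

Lemma mean_cube_cons n (i : 'I_n.+1) (F : cube n.+1 -> R) :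
  mean F = (mean (fun x => F (cube_cons i false x)) +
            mean (fun x => F (cube_cons i true x))) / 2.
Proof.
rewrite /mean (bigID (fun x : cube n.+1 => x i == false))/= sum_cube_cons.
rewrite (eq_bigl (fun x : cube n.+1 => x i == true)); last first.
  by move=> x; case: (x i).
rewrite sum_cube_cons !card_cube expnS natrM.
by field; rewrite pnatr_eq0 expn_eq0.
Qed.

Definition rademacher_sum n (u : 'I_n -> R) (x : cube n) : R :=
  \sum_i u i * coordinate i x.

Lemma rademacher_sum_cons n (i : 'I_n.+1) (u : 'I_n.+1 -> R) b (x : cube n) :
  rademacher_sum u (cube_cons i b x) =
  u i * (-1) ^+ b + rademacher_sum (fun j => u (lift i j)) x.
Proof.
rewrite /rademacher_sum (bigD1_ord i)//= /coordinate cube_cons_i.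
by congr (_ + _); apply: eq_bigr => j _; rewrite cube_cons_lift.
Qed.

Lemma mean_rademacher_sum n (i : 'I_n.+1) (u : 'I_n.+1 -> R) (F : R -> R) :
  mean (fun x => F (rademacher_sum u x)) =
  (mean (fun x => F (rademacher_sum (fun j => u (lift i j)) x + u i)) +
   mean (fun x => F (rademacher_sum (fun j => u (lift i j)) x - u i))) / 2.
Proof.
rewrite (mean_cube_cons i); congr ((_ + _) / 2); apply: eq_mean => x;
  by rewrite rademacher_sum_cons ?expr0 ?expr1 ?mulr1 ?mulrN1 addrC.
Qed.

Lemma rademacher_sum0 (u : 'I_0 -> R) x : rademacher_sum u x = 0.
Proof. by rewrite /rademacher_sum big_ord0. Qed.

(** The shift [z] absorbs one coordinate at each step of the induction on the dimension; likewise
    for the cosine below. *)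
Lemma mean_rademacher_sqr n (u : 'I_n -> R) z :
  mean (fun x => (z + rademacher_sum u x) ^+ 2) = z ^+ 2 + \sum_i u i ^+ 2.
Proof.
elim: n u z => [|n IH] u z.
  rewrite big_ord0 (eq_mean (G := fun=> z ^+ 2)) ?mean_cst ?addr0// => x.
  by rewrite rademacher_sum0 addr0.
rewrite (mean_rademacher_sum ord0 u (fun y => (z + y) ^+ 2)) (bigD1_ord ord0)//=.
under eq_mean do rewrite addrCA addrC.
under [X in _ + X]eq_mean do rewrite addrCA addrC.
by rewrite !IH; field.
Qed.

Lemma mean_rademacher_cos n (u : 'I_n -> R) t z :
  mean (fun x => cos (z + t * rademacher_sum u x)) =
  cos z * \prod_i cos (t * u i).
Proof.
elim: n u z => [|n IH] u z.
  rewrite big_ord0 mulr1 (eq_mean (G := fun=> cos z)) ?mean_cst// => x.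
  by rewrite rademacher_sum0 mulr0 addr0.
rewrite (mean_rademacher_sum ord0 u (fun y => cos (z + t * y))).
rewrite [in RHS](bigD1_ord ord0)//=.
under eq_mean do rewrite mulrDr addrCA addrC.
under [X in _ + X]eq_mean do rewrite mulrBr addrCA addrC.
by rewrite !IH cosD cosB; field.
Qed.

End Cube.

(** * Taylor bounds *)

Section Taylor.
Variable R : realType.
Implicit Types x y : R.

Lemma is_derive_ge f g df dg x : 0 <= x ->
  (forall t : R, is_derive t 1 f (df t)) ->
  (forall t : R, is_derive t 1 g (dg t)) ->
  f 0 = g 0 :> R -> (forall t, 0 <= t -> df t <= dg t) -> f x <= g x.
Proof.
move=> x0 fd gd fg0 fg; rewrite -subr_ge0.
rewrite (_ : 0 = g 0 - f 0); last by rewrite fg0 subrr.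
apply: (@is_derive_homo _ (fun t => g t - f t) (fun t => dg t - df t)) => // t t0.
by rewrite subr_ge0 fg//; case/andP: t0.
Qed.

Definition taylor_term n x : R := x ^+ n / n`!%:R.

Lemma taylor_term0 x : taylor_term 0 x = 1.
Proof. by rewrite /taylor_term expr0 divr1. Qed.

Lemma taylor_termS0 n : taylor_term n.+1 0 = 0.
Proof. by rewrite /taylor_term expr0n mul0r. Qed.

Lemma taylor_termS n x : taylor_term n.+1 x = taylor_term n x * x / n.+1%:R.
Proof.
rewrite /taylor_term exprSr factS natrM; field.
by rewrite nat1r !pnatr_eq0/= -lt0n fact_gt0.
Qed.

Lemma is_derive_taylor_term n x :
  is_derive x 1 (taylor_term n.+1) (taylor_term n x).
Proof.
have d := is_derive_exprn x n.
rewrite (_ : taylor_term _ = n.+1`!%:R^-1 *: (fun t : R => t ^+ n.+1)); last first.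
  by apply/funext => t; rewrite /taylor_term mulrC.
apply: is_derive_eq; rewrite /taylor_term /GRing.scale/= factS natrM; field.
by rewrite nat1r !pnatr_eq0/= -lt0n fact_gt0.
Qed.

(* Taylor polynomials of the cosine for [k = 0] and of the sine for [k = 1]. *)
Definition alt_taylor k n x : R := \sum_(i < n) (-1) ^+ i * taylor_term (k + i.*2) x.

Lemma alt_taylor00 n : alt_taylor 0 n.+1 0 = 1.
Proof.
rewrite /alt_taylor big_ord_recl taylor_term0 big1 ?addr0 ?mulr1// => i _.
by rewrite doubleS taylor_termS0 mulr0.
Qed.

Lemma alt_taylorS0 k n : alt_taylor k.+1 n 0 = 0.
Proof. by rewrite /alt_taylor big1 // => i _; rewrite taylor_termS0 mulr0. Qed.

Lemma is_derive_alt_taylor k n x :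
  is_derive x 1 (alt_taylor k.+1 n) (alt_taylor k n x).
Proof.
elim: n => [|n IH].
  rewrite (_ : alt_taylor _ _ = cst 0); last first.
    by apply/funext => t; rewrite /alt_taylor big_ord0.
  by rewrite /alt_taylor big_ord0; exact: is_derive_cst.
have d := is_derive_taylor_term (k + n.*2) x.
rewrite (_ : alt_taylor k.+1 n.+1 = alt_taylor k.+1 n +
    (-1) ^+ n *: taylor_term (k + n.*2).+1); last first.
  by apply/funext => t; rewrite /alt_taylor big_ord_recr.
apply: (is_derive_eq (is_deriveD IH (is_deriveZ _ d))).
by rewrite [in RHS]/alt_taylor big_ord_recr.
Qed.

Lemma is_derive_alt_taylor0 n x :
  is_derive x 1 (alt_taylor 0 n.+1) (- alt_taylor 1 n x).
Proof.
rewrite (_ : alt_taylor 0 n.+1 = cst 1 - alt_taylor 2 n); last first.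
  apply/funext => t; rewrite /alt_taylor big_ord_recl/= taylor_term0 expr0 mulr1.
  rewrite !fctE -sumrN; congr (_ + _); apply: eq_bigr => i _.
  by rewrite exprS mulN1r mulNr.
have d := is_derive_alt_taylor 1 n x.
by apply: is_derive_eq; rewrite sub0r.
Qed.

(** Integrating from 0 turns each bound for the cosine into one for the sine, and that one into the
    next bound for the cosine. The factor [(-1) ^+ n] treats upper and lower bounds at once. *)
Lemma cos_sin_taylor n x : 0 <= x ->
  (-1) ^+ n * cos x <= (-1) ^+ n * alt_taylor 0 n.+1 x /\
  (-1) ^+ n * sin x <= (-1) ^+ n * alt_taylor 1 n.+1 x.
Proof.
elim: n x => [|n IH] x x0.
  have c y : 0 <= y -> cos y <= alt_taylor 0 1 y.
    by rewrite /alt_taylor big_ord1 taylor_term0 mul1r cos_le1.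
  rewrite !expr0 !mul1r; split; first exact: c.
  apply: (is_derive_ge x0 (@is_derive_sin R) (is_derive_alt_taylor 0 1)) => //.
  by rewrite sin0 alt_taylorS0.
have c y : 0 <= y ->
    (-1) ^+ n.+1 * cos y <= (-1) ^+ n.+1 * alt_taylor 0 n.+2 y.
  move=> y0; apply: (@is_derive_ge (fun t => (-1) ^+ n.+1 * cos t)
    (fun t => (-1) ^+ n.+1 * alt_taylor 0 n.+2 t)
    (fun t => (-1) ^+ n * sin t)
    (fun t => (-1) ^+ n * alt_taylor 1 n.+1 t)) => //.
  - move=> t; have := is_deriveZ ((-1) ^+ n.+1) (is_derive_cos t).
    by rewrite /GRing.scale/= exprS mulN1r mulrNN.
  - move=> t; have := is_deriveZ ((-1) ^+ n.+1) (is_derive_alt_taylor0 n.+1 t).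
    by rewrite /GRing.scale/= exprS mulN1r mulrNN.
  - by rewrite cos0 alt_taylor00.
  - by move=> t /IH[].
split; first exact: c.
apply: (@is_derive_ge (fun t => (-1) ^+ n.+1 * sin t)
    (fun t => (-1) ^+ n.+1 * alt_taylor 1 n.+2 t)
    (fun t => (-1) ^+ n.+1 * cos t)
    (fun t => (-1) ^+ n.+1 * alt_taylor 0 n.+2 t)) => //.
- by move=> t; have := is_deriveZ ((-1) ^+ n.+1) (is_derive_alt_taylor 0 n.+2 t).
- by rewrite sin0 alt_taylorS0.
Qed.

End Taylor.

(** * Rational bounds for [pi], the exponential and the Gaussian distribution *)

Section NumericBounds.
Variable R : realType.
Implicit Types x y : R.

Lemma alt_taylor_cos x : let y := x ^+ 2 in
  alt_taylor 0 6 x =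
  1 - y / 2 * (1 - y / 12 * (1 - y / 30 * (1 - y / 56 * (1 - y / 90)))).
Proof.
rewrite /alt_taylor !big_ord_recr big_ord0 /= !taylor_termS taylor_term0.
by field.
Qed.

Lemma cos_ge10 x : 0 <= x -> let y := x ^+ 2 in
  1 - y / 2 * (1 - y / 12 * (1 - y / 30 * (1 - y / 56 * (1 - y / 90)))) <= cos x.
Proof.
move=> x0; have [+ _] := cos_sin_taylor 5 x0.
by rewrite alt_taylor_cos -signr_odd expr1 !mulN1r lerN2.
Qed.

Lemma cos_le8 x : 0 <= x -> let y := x ^+ 2 in
  cos x <= 1 - y / 2 * (1 - y / 12 * (1 - y / 30 * (1 - y / 56))).
Proof.
move=> x0; have [+ _] := cos_sin_taylor 4 x0.
rewrite -signr_odd expr0 !mul1r => /le_trans; apply.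
rewrite /alt_taylor !big_ord_recr big_ord0 /= !taylor_termS taylor_term0.
by rewrite -subr_ge0 (_ : _ - _ = 0)//; field.
Qed.

(** The cosine vanishes at [pi / 2], so its sign at a rational point, read off a Taylor polynomial,
    tells on which side that point lies. *)
Lemma pi_gt157 : 157 / 50 < pi :> R.
Proof.
rewrite ltNge; apply/negP => pile.
have p2 : pi / 2 <= 157 / 100 :> R by lra.
have c0 : 0 < cos (157 / 100 : R).
  apply: lt_le_trans (cos_ge10 _); first by lra.
  by lra.
have : cos (157 / 100 : R) <= cos (pi / 2).
  have := pi_ge2 R => pi2.
  by rewrite leNgt ltr_cos -?leNgt// in_itv/=; apply/andP; split; lra.
by rewrite cos_pihalf; lra.
Qed.

Lemma pi_lt227 : pi < 22 / 7 :> R.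
Proof.
rewrite ltNge; apply/negP => pile.
have p2 : 11 / 7 <= pi / 2 :> R by lra.
have c0 : cos (11 / 7 : R) < 0.
  by apply: le_lt_trans (cos_le8 _) _; lra.
have : cos (pi / 2) <= cos (11 / 7 : R).
  by rewrite leNgt ltr_cos -?leNgt// in_itv/=; apply/andP; split; lra.
by rewrite cos_pihalf; lra.
Qed.

Lemma peak_bounds : 67 / 168 < peak R < 85 / 213.
Proof.
have p : peak R ^+ 2 * (2 * pi) = 1.
  by rewrite sqr_peak mulVf// gt_eqF// mulr_gt0 ?pi_gt0.
have := pi_gt157; have := pi_lt227; have := peak_gt0 R.
by rewrite expr2 in p * => p0 h1 h2; apply/andP; split; nra.
Qed.

(** The Taylor polynomial of [expR (- x)], with [n] terms. *)
Definition exp_taylor n x : R := \sum_(i < n) (-1) ^+ i * taylor_term i x.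

Lemma is_derive_exp_taylor n x :
  is_derive x 1 (exp_taylor n.+1) (- exp_taylor n x).
Proof.
elim: n => [|n IH].
  rewrite (_ : exp_taylor _ = cst 1); last first.
    by apply/funext => t; rewrite /exp_taylor big_ord1 taylor_term0 mulr1.
  by rewrite /exp_taylor big_ord0 oppr0; exact: is_derive_cst.
have d := is_derive_taylor_term n x.
rewrite (_ : exp_taylor n.+2 = exp_taylor n.+1 +
    (-1) ^+ n.+1 *: taylor_term n.+1); last first.
  by apply/funext => t; rewrite /exp_taylor big_ord_recr.
apply: (is_derive_eq (is_deriveD IH (is_deriveZ _ d))).
rewrite [in RHS]/exp_taylor big_ord_recr/= opprD.
by rewrite exprS mulN1r scaleNr.
Qed.

Lemma exp_taylor0 n : exp_taylor n.+1 0 = 1.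
Proof.
rewrite /exp_taylor big_ord_recl taylor_term0 big1 ?addr0 ?mulr1// => i _.
by rewrite taylor_termS0 mulr0.
Qed.

Lemma expRN_taylor n x : 0 <= x ->
  (-1) ^+ n * expR (- x) <= (-1) ^+ n * exp_taylor n.+1 x.
Proof.
elim: n x => [|n IH] x x0.
  by rewrite /exp_taylor big_ord1 taylor_term0 !expr0 !mul1r expR_le1 oppr_le0.
apply: (@is_derive_ge _ (fun t => (-1) ^+ n.+1 * expR (- t))
  (fun t => (-1) ^+ n.+1 * exp_taylor n.+2 t)
  (fun t => (-1) ^+ n * expR (- t))
  (fun t => (-1) ^+ n * exp_taylor n.+1 t)) => //.
- by move=> t; apply: trigger_derive; rewrite /GRing.scale/= exprS; ring.
- move=> t; have := is_deriveZ ((-1) ^+ n.+1) (is_derive_exp_taylor n.+1 t).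
  by rewrite /GRing.scale/= exprS mulN1r mulrNN.
- by rewrite oppr0 expR0 exp_taylor0.
Qed.

(** The integral of [exp_taylor n (t ^+ 2 / 2)] over [[0, x]]; times [peak] it approximates
    [gauss_cdf x - 1 / 2]. *)
Definition gauss_taylor n x : R :=
  \sum_(i < n) (-1) ^+ i * (x ^+ i.*2.+1 / (2 ^+ i * i`!%:R * i.*2.+1%:R)).

Lemma is_derive_gauss_taylor n x :
  is_derive x 1 (gauss_taylor n) (exp_taylor n (x ^+ 2 / 2)).
Proof.
elim: n => [|n IH].
  rewrite (_ : gauss_taylor _ = cst 0); last first.
    by apply/funext => t; rewrite /gauss_taylor big_ord0.
  by rewrite /exp_taylor big_ord0; exact: is_derive_cst.
have d := is_derive_exprn x n.*2.
rewrite (_ : gauss_taylor n.+1 = gauss_taylor n + ((-1) ^+ n /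
    (2 ^+ n * n`!%:R * n.*2.+1%:R)) *: (fun t : R => t ^+ n.*2.+1)); last first.
  apply/funext => t; rewrite /gauss_taylor big_ord_recr/=; congr (_ + _).
  by rewrite /GRing.scale/= mulrA mulrAC.
apply: (is_derive_eq (is_deriveD IH (is_deriveZ _ d))).
rewrite /exp_taylor big_ord_recr/=; congr (_ + _).
rewrite /taylor_term /GRing.scale/= -mul2n exprM expr_div_n; field.
by rewrite -natrM nat1r !pnatr_eq0/= -lt0n fact_gt0 expf_neq0 ?pnatr_eq0.
Qed.

Lemma gauss_cdf_taylor n x : 0 <= x ->
  (-1) ^+ n * (gauss_cdf x - 1 / 2) <=
  (-1) ^+ n * (peak R * gauss_taylor n.+1 x).
Proof.
move=> x0.
apply: (@is_derive_ge _ (fun t => (-1) ^+ n * (gauss_cdf t - 1 / 2))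
  (fun t => (-1) ^+ n * (peak R * gauss_taylor n.+1 t))
  (fun t => (-1) ^+ n * gauss_pdf t)
  (fun t => (-1) ^+ n * (peak R * exp_taylor n.+1 (t ^+ 2 / 2)))) => //.
- by move=> t; apply: trigger_derive; rewrite /GRing.scale/=; ring.
- move=> t; have := is_deriveZ (peak R) (is_derive_gauss_taylor n.+1 t).
  by move/(is_deriveZ ((-1) ^+ n)).
- rewrite gauss_cdf0 subrr /gauss_taylor big1 ?mulr0// => i _.
  by rewrite expr0n/= mul0r mulr0.
- move=> t t0; rewrite gauss_pdfE !(mulrCA _ (peak R)) ler_pM2l ?peak_gt0//.
  by apply: expRN_taylor; rewrite divr_ge0 ?sqr_ge0.
Qed.

End NumericBounds.

(** * Khinchine inequality with remainder *)

Section SmoothAbs.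
Variable R : realType.
Implicit Types (x y z s t u : R).
Local Notation phi := (@gauss_pdf R).
Local Notation Phi := (@gauss_cdf R).
Local Notation peak := (peak R).

(** The function [phi t / t - (1 - Phi t)] decreases, with derivative [- phi t / t ^+ 2], and stays
    above [Phi t - 1], which tends to 0. *)
Lemma gauss_mills x : 0 < x -> x * (1 - Phi x) <= phi x.
Proof.
move=> x0; rewrite mulrC -ler_pdivlMr// -subr_ge0.
pose g t := phi t / t - (1 - Phi t).
rewrite -/(g x).
have gg y : x <= y -> Phi y - 1 <= g x.
  move=> xy; apply: (@le_trans _ _ (g y)).
    by rewrite /g opprB lerDr divr_ge0 ?(ltW (gauss_pdf_gt0 _))//
      (le_trans _ xy) ?ltW.
  rewrite -lerN2; apply: (@is_derive_homo _ (fun t => - g t)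
    (fun t => phi t / t ^+ 2) _ _ xy) => t /andP[xt _].
    have t0 : t != 0 by rewrite gt_eqF// (lt_le_trans x0).
    have dv : is_derive t 1 (fun t : R => t^-1) (- t ^- 2 *: 1).
      exact: (@is_deriveV _ id).
    by rewrite /g; apply: trigger_derive; rewrite /GRing.scale/=; field.
  by rewrite divr_ge0 ?sqr_ge0 ?(ltW (gauss_pdf_gt0 _)).
have l : (Phi y - 1) @[y --> +oo] --> (0 : R).
  by rewrite -(subrr 1); apply: cvgB; [exact: gauss_cdf_cvgy|exact: cvg_cst].
apply: (cvgr_to_le l); near=> y; apply: gg.
by near: y; exact: nbhs_pinfty_ge (num_real x).
Unshelve. all: by end_near. Qed.

(** The error of the trapezoid rule is [- (b - a) ^+ 3 / 12] times a value of the second derivative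
    [(x ^+ 2 - 1) * phi x], which is at least [- peak]; [mono] expresses this lower bound. *)
Lemma trapezoid_pdf a b : a <= b ->
  Phi b - Phi a <= (b - a) * (phi a + phi b) / 2 + peak * (b - a) ^+ 3 / 12.
Proof.
move=> ab.
have mono s t : s <= t -> t * phi t - peak * t <= s * phi s - peak * s.
  move=> st; rewrite -lerN2.
  apply: (@is_derive_homo _ (fun x => - (x * phi x - peak * x))
    (fun x => peak - phi x + x ^+ 2 * phi x) _ _ st) => y _.
    by apply: trigger_derive; rewrite /GRing.scale/=; ring.
  have p0 := ltW (gauss_pdf_gt0 y).
  by rewrite addr_ge0 ?subr_ge0 ?gauss_pdf_le_peak// mulr_ge0 ?sqr_ge0.
have tangent t : a <= t ->
    0 <= phi a - phi t - (t - a) * (t * phi t) + peak * (t - a) ^+ 2 / 2.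
  move=> at_.
  pose d x := - (phi x - phi t - (t - x) * (t * phi t) + peak * (t - x) ^+ 2 / 2).
  suff : d a <= d t by rewrite /d !subrr expr0n /= !mulr0 !mul0r; lra.
  apply: (@is_derive_homo _ d (fun x => x * phi x - peak * x -
    (t * phi t - peak * t)) _ _ at_) => y.
    by move=> _; rewrite /d; apply: trigger_derive; rewrite /GRing.scale/=; field.
  by case/andP => _ yt; rewrite subr_ge0 mono.
pose f t := (t - a) * (phi a + phi t) / 2 + peak * (t - a) ^+ 3 / 12 -
  (Phi t - Phi a).
suff : f a <= f b by rewrite /f !subrr expr0n/= !mul0r mulr0 mul0r; lra.
apply: (@is_derive_homo _ f (fun t => (phi a - phi t - (t - a) * (t * phi t) +
    peak * (t - a) ^+ 2 / 2) / 2) _ _ ab) => t.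
  by move=> _; rewrite /f; apply: trigger_derive; rewrite /GRing.scale/=; field.
by case/andP => at_ _; rewrite divr_ge0 ?tangent.
Qed.

(* [smooth_abs x s] is the mean of [|x + s G|] for a standard Gaussian [G]. *)
Definition smooth_abs x s : R := 2 * s * phi (x / s) + x * (2 * Phi (x / s) - 1).

Lemma smooth_absN x s : smooth_abs (- x) s = smooth_abs x s.
Proof. by rewrite /smooth_abs mulNr gauss_pdfN gauss_cdfN; ring. Qed.

Lemma smooth_abs0 s : smooth_abs 0 s = 2 * peak * s.
Proof. by rewrite /smooth_abs !mul0r addr0 gauss_pdf0; ring. Qed.

(** For [x > 0] and [y = x / s] the difference is [2 * s * (phi y - y * (1 - Phi y))], nonnegative
    by [gauss_mills]. *)
Lemma smooth_abs_ge x s : 0 < s -> `|x| <= smooth_abs x s.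
Proof.
move=> s0; wlog x0 : x / 0 <= x.
  by case: (leP 0 x) => [x0 /(_ x x0)//|/ltW x0 H]; rewrite -normrN -smooth_absN H ?oppr_ge0.
rewrite ger0_norm//; move: x0; rewrite le_eqVlt => /predU1P[<-|x0].
  by rewrite smooth_abs0 !mulr_ge0 ?(ltW (peak_gt0 _)) ?ltW.
have := gauss_mills (divr_gt0 x0 s0); rewrite /smooth_abs => h.
have xs : x = s * (x / s) by field; rewrite gt_eqF.
rewrite {1 3}xs; nra.
Qed.

(** The contributions of the inner derivative of [x / s] cancel because [phi] has derivative
    [- y * phi y]. *)
Lemma is_derive_smooth_abs (X S : R -> R) (dX dS : R) t :
  is_derive t 1 X dX -> is_derive t 1 S dS -> 0 < S t ->
  is_derive t 1 (fun r => smooth_abs (X r) (S r))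
    ((2 * Phi (X t / S t) - 1) * dX + 2 * phi (X t / S t) * dS).
Proof.
move=> hX hS S0; have Sn0 : S t != 0 by rewrite gt_eqF.
by rewrite /smooth_abs; apply: trigger_derive; rewrite /GRing.scale/=; field.
Qed.

(* Rotating [(|u|, s)] onto the axis [(0, r)] interpolates between the two
   sides; the derivative along the way is a trapezoid-rule error. *)
Lemma smooth_abs_rotate x r al : 0 < r -> 0 <= al < pi / 2 ->
  (smooth_abs (x + r * sin al) (r * cos al) +
   smooth_abs (x - r * sin al) (r * cos al)) / 2 <=
  smooth_abs x r + 2 * peak / 3 * (r * (1 - cos al) ^+ 2 / cos al).
Proof.
move=> r0 /andP[al0 alpi].
(* The correction [r * ((cos t)^-1 + cos t)] has derivative [r * sin t ^+ 3 / cos t ^+ 2], which is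
   the form of the trapezoid error at angle [t]. *)
pose f t := - ((smooth_abs (x + r * sin t) (r * cos t) +
   smooth_abs (x - r * sin t) (r * cos t)) / 2 -
   2 * peak / 3 * (r * ((cos t)^-1 + cos t))).
have cos_pos t : 0 <= t <= al -> 0 < cos t.
  move=> /andP[t0 tal]; apply: cos_gt0_pihalf; rewrite (le_lt_trans tal alpi).
  by rewrite (lt_le_trans _ t0)// oppr_lt0 divr_gt0 ?pi_gt0.
suff : f 0 <= f al.
  have c0 : 0 < cos al by apply: cos_pos; rewrite al0/=.
  rewrite /f sin0 cos0 mulr0 addr0 subr0 mulr1 invr1.
  have -> : 2 * peak / 3 * (r * (1 - cos al) ^+ 2 / cos al) =
    2 * peak / 3 * (r * ((cos al)^-1 + cos al)) - 2 * peak / 3 * (r * 2).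
    by field; rewrite gt_eqF.
  by lra.
pose D t := r * cos t * ((x + r * sin t) / (r * cos t) -
  (x - r * sin t) / (r * cos t)) * (phi ((x + r * sin t) / (r * cos t)) +
  phi ((x - r * sin t) / (r * cos t))) / 2 + 2 * peak / 3 * (r * sin t ^+ 3 / cos t ^+ 2) -
  r * cos t * (Phi ((x + r * sin t) / (r * cos t)) - Phi ((x - r * sin t) / (r * cos t))).
apply: (@is_derive_homo _ f D _ _ al0) => t tal.
  have c0 := cos_pos t tal.
  have dS : is_derive t 1 (fun t => r * cos t) (- (r * sin t)).
    by apply: trigger_derive; rewrite /GRing.scale/=; ring.
  have dX1 : is_derive t 1 (fun t => x + r * sin t) (r * cos t).
    by apply: trigger_derive; rewrite /GRing.scale/=; ring.
  have dX2 : is_derive t 1 (fun t => x - r * sin t) (- (r * cos t)).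
    by apply: trigger_derive; rewrite /GRing.scale/=; ring.
  have rc0 : 0 < r * cos t by rewrite mulr_gt0.
  have d1 := is_derive_smooth_abs dX1 dS rc0.
  have d2 := is_derive_smooth_abs dX2 dS rc0.
  have cn0 : cos t != 0 by rewrite gt_eqF.
  have s2 : sin t ^+ 2 = 1 - cos t ^+ 2 by exact: sin2cos2.
  rewrite /f; apply: trigger_derive; rewrite /GRing.scale/= /D.
  have -> : sin t ^+ 3 = sin t * (1 - cos t ^+ 2) by rewrite exprS s2.
  by field; rewrite cn0 gt_eqF.
have c0 := cos_pos t tal.
have rc0 : 0 < r * cos t by rewrite mulr_gt0.
have s0 : 0 <= sin t.
  apply: sin_ge0_pi; case/andP: tal => -> /= tal.
  by rewrite (le_trans tal)// (le_trans (ltW alpi))// ler_piMr ?pi_ge0//; lra.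
set a := (x - r * sin t) / (r * cos t); set b := (x + r * sin t) / (r * cos t).
have ab : b - a = 2 * (sin t / cos t).
  by rewrite /a /b; field; rewrite !gt_eqF.
have ab0 : a <= b by rewrite -subr_ge0 ab mulr_ge0// divr_ge0// ltW.
have := trapezoid_pdf ab0; rewrite -(ler_pM2l rc0) ab => h.
rewrite /D -/a -/b ab.
suff e : 2 * peak / 3 * (r * sin t ^+ 3 / cos t ^+ 2) =
  r * cos t * (peak * (2 * (sin t / cos t)) ^+ 3 / 12) by rewrite e; lra.
by field; rewrite gt_eqF.
Qed.

(** One replacement step: the random sign of [u] is traded for the additional Gaussian variance
    [u ^+ 2]. The angle of rotation has cosine [s / r] and sine [u / r]. *)
Lemma smooth_abs_step x s u r : 0 < s -> 0 <= r -> r ^+ 2 = s ^+ 2 + u ^+ 2 ->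
  (smooth_abs (x + u) s + smooth_abs (x - u) s) / 2 <=
  smooth_abs x r + 2 * peak / 3 * ((r - s) ^+ 2 / s).
Proof.
move=> s0 r_ge0 r2; wlog u0 : u r2 / 0 <= u.
  move=> H; case: (leP 0 u) => [/(H _ r2)//|/ltW u0].
  have := H (- u); rewrite oppr_ge0 sqrrN opprK => /(_ r2 u0).
  by rewrite [smooth_abs (x - u) s + _]addrC.
have r0 : 0 < r.
  by rewrite lt_neqAle r_ge0 andbT eq_sym -sqrf_eq0 r2 gt_eqF// ltr_pwDl ?exprn_gt0 ?sqr_ge0.
have sr : s <= r by rewrite -ler_sqr ?nnegrE ?(ltW s0)// r2 lerDl sqr_ge0.
have sr1 : -1 <= s / r <= 1.
  by rewrite ler_pdivrMr// mul1r sr andbT (le_trans _ (divr_ge0 (ltW s0) (ltW r0))).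
have cE : cos (acos (s / r)) = s / r by rewrite acosK// in_itv.
have sE : sin (acos (s / r)) = u / r.
  rewrite sin_acos//; have -> : 1 - (s / r) ^+ 2 = (u / r) ^+ 2.
    rewrite !expr_div_n (_ : u ^+ 2 = r ^+ 2 - s ^+ 2); last by lra.
    by field; rewrite gt_eqF.
  by rewrite sqrtr_sqr ger0_norm// divr_ge0.
have al : 0 <= acos (s / r) < pi / 2.
  rewrite acos_ge0//= ltNge; apply/negP => h.
  have : cos (acos (s / r)) <= cos (pi / 2).
    rewrite leNgt ltr_cos ?in_itv/= ?acos_ge0 ?acos_lepi// -?leNgt//.
    by rewrite divr_ge0 ?pi_ge0//= ler_piMr ?pi_ge0//; lra.
  by rewrite cE cos_pihalf leNgt divr_gt0.
have := smooth_abs_rotate x r0 al; rewrite cE sE !(mulrC r (_ / r)) !divfK ?gt_eqF//.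
move=> /le_trans; apply.
suff -> : r * (1 - s / r) ^+ 2 / (s / r) = (r - s) ^+ 2 / s by [].
by field; rewrite !gt_eqF.
Qed.

End SmoothAbs.

(** * Lindeberg replacement; Khinchine for small and for large entries *)

Section Lindeberg.
Variable R : realType.
Local Notation peak := (peak R).
Local Notation smooth_abs := (@smooth_abs R).

(** In this form the errors telescope over the coordinates. The factor [7 / 9] gives
    [r <= 4 / 3 * s], so [r / (r + s) <= 4 / 7], and [8 / 21] is [2 / 3 * (4 / 7)]. *)
Lemma smooth_abs_cost (M s r u : R) : 0 < s -> 0 <= r ->
  r ^+ 2 = s ^+ 2 + u ^+ 2 -> u ^+ 2 <= M ^+ 2 -> M ^+ 2 <= 7 / 9 * s ^+ 2 ->
  2 / 3 * ((r - s) ^+ 2 / s) <= 8 / 21 * M ^+ 2 * (s^-1 - r^-1).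
Proof.
move=> s0 r_ge0 r2 uM Ms.
have sr : s <= r by rewrite -ler_sqr ?nnegrE ?(ltW s0)// r2 lerDl sqr_ge0.
have r0 : 0 < r := lt_le_trans s0 sr.
have r43 : r <= 4 / 3 * s.
  by rewrite -ler_sqr ?nnegrE ?mulr_ge0 ?(ltW s0)// r2 exprMn; lra.
have key : r * (r - s) <= 4 / 7 * M ^+ 2.
  rewrite -(ler_pM2r (addr_gt0 r0 s0)).
  have -> : r * (r - s) * (r + s) = r * u ^+ 2.
    by rewrite -mulrA -subr_sqr r2; ring.
  have := ler_wpM2l r_ge0 uM; have := sqr_ge0 M; nra.
have -> : 2 / 3 * ((r - s) ^+ 2 / s) = 2 / 3 * (r * (r - s)) * (s^-1 - r^-1).
  by field; rewrite !gt_eqF.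
apply: ler_wpM2r; last by lra.
by rewrite subr_ge0 lef_pV2 ?posrE.
Qed.

Lemma lindeberg (M : R) n (u : 'I_n -> R) (s r z : R) :
  (forall i, u i ^+ 2 <= M ^+ 2) -> M ^+ 2 <= 7 / 9 * s ^+ 2 ->
  0 < s -> 0 <= r -> r ^+ 2 = s ^+ 2 + \sum_i u i ^+ 2 ->
  mean (fun x => smooth_abs (z + rademacher_sum u x) s) <=
  smooth_abs z r + peak * (8 / 21 * M ^+ 2 * (s^-1 - r^-1)).
Proof.
elim: n u s z => [|n IH] u s z uM Ms s0 r0 r2.
  have <- : s = r.
    by apply/eqP; rewrite -(@eqrXn2 _ 2)// ?(ltW s0)// r2 big_ord0 addr0.
  rewrite subrr !mulr0 addr0 (eq_mean (G := fun=> smooth_abs z s)) ?mean_cst//.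
  by move=> x; rewrite rademacher_sum0 addr0.
pose s1 : R := Num.sqrt (s ^+ 2 + u ord0 ^+ 2).
have s12 : s1 ^+ 2 = s ^+ 2 + u ord0 ^+ 2.
  by rewrite sqr_sqrtr// addr_ge0 ?sqr_ge0.
have ss1 : s <= s1.
  by rewrite -ler_sqr ?nnegrE ?sqrtr_ge0 ?(ltW s0)// s12 lerDl sqr_ge0.
have s10 : 0 < s1 := lt_le_trans s0 ss1.
pose v j := u (lift ord0 j).
rewrite (mean_rademacher_sum ord0 u (fun y => smooth_abs (z + y) s)) -meanD.
rewrite mulrC -meanZ.
have Ms1 : M ^+ 2 <= 7 / 9 * s1 ^+ 2 by have := sqr_ge0 (u ord0); lra.
have r2' : r ^+ 2 = s1 ^+ 2 + \sum_j v j ^+ 2.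
  by rewrite r2 (bigD1_ord ord0)//= s12 addrA.
have H := IH v s1 z (fun j => uM (lift ord0 j)) Ms1 s10 r0 r2'.
have C := smooth_abs_cost s0 (ltW s10) s12 (uM ord0) Ms.
apply: (@le_trans _ _ (mean (fun x => smooth_abs (z + rademacher_sum v x) s1 +
    peak * (8 / 21 * M ^+ 2 * (s^-1 - s1^-1))))).
  apply: ler_mean => x; rewrite !(addrA z).
  have := smooth_abs_step (z + rademacher_sum v x) s0 (ltW s10) s12.
  have := ler_wpM2l (ltW (peak_gt0 R)) C.
  by rewrite -/v; lra.
by rewrite meanD mean_cst; lra.
Qed.

Lemma khinchine_small n (u : 'I_n -> R) (M : R) :
  \sum_i u i ^+ 2 = 1 -> (forall i, `|u i| <= M) -> 0 < M -> M <= 1 / 8 ->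
  mean (fun x => `|rademacher_sum u x|) <= 2 * peak + (1 - 2 * peak) * M.
Proof.
move=> u1 uM M0 M8.
(* The variance [M / 6] of the smoothing balances [2 peak (r - 1)] against the
   replacement error, which is of order [M ^ 2 / s]. *)
pose s : R := Num.sqrt (M / 6); pose r : R := Num.sqrt (1 + M / 6).
have s2 : s ^+ 2 = M / 6 by rewrite sqr_sqrtr//; lra.
have r2 : r ^+ 2 = 1 + M / 6 by rewrite sqr_sqrtr//; lra.
have s0 : 0 < s by rewrite sqrtr_gt0; lra.
have r0 : 0 <= r by rewrite sqrtr_ge0.
have uM2 i : u i ^+ 2 <= M ^+ 2.
  by rewrite -real_normK ?num_real// lerXn2r ?nnegrE ?(ltW M0).
have Ms : M ^+ 2 <= 7 / 9 * s ^+ 2 by rewrite s2 expr2; nra.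
have r2' : r ^+ 2 = s ^+ 2 + \sum_i u i ^+ 2 by rewrite u1 r2 s2; lra.
have := lindeberg 0 uM2 Ms s0 r0 r2'; rewrite smooth_abs0 => H.
have r1 : r <= 1 + M / 12 by rewrite expr2 in r2; nra.
have r_gt0 : 0 < r by rewrite sqrtr_gt0; lra.
have Mb : M ^+ 2 * (s^-1 - r^-1) <= 6 * M * s.
  apply: (@le_trans _ _ (M ^+ 2 * s^-1)).
    by rewrite ler_wpM2l ?sqr_ge0// lerBlDr lerDl invr_ge0.
  have -> : M = 6 * s ^+ 2 by lra.
  rewrite le_eqVlt; apply/orP; left; apply/eqP; field.
  by rewrite gt_eqF.
have s145 : s <= 29 / 200 by rewrite expr2 in s2; nra.
have /andP[p1 p2] := peak_bounds R; have p0 := peak_gt0 R.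
apply: (@le_trans _ _ (mean (fun x => smooth_abs (0 + rademacher_sum u x) s))).
  by apply: ler_mean => x; rewrite add0r smooth_abs_ge.
apply: le_trans H _.
have Mb' : M ^+ 2 * (s^-1 - r^-1) <= 87 / 100 * M by nra.
have : 8 / 21 * M ^+ 2 * (s^-1 - r^-1) <= 1 / 3 * M by lra.
move=> /(ler_wpM2l (ltW p0)) h1; have := ler_wpM2l (ltW p0) r1 => h2.
(* The two errors add up to at most [peak * M / 2], which is below [(1 - 2 * peak) * M] as soon as
   [peak <= 2 / 5]. *)
have h3 : peak * M <= 2 / 5 * M by rewrite ler_wpM2r ?(ltW M0)//; lra.
lra.
Qed.

(* The other signs only enter through [E Y^2]: averaging over the sign of the
   largest coefficient gives [max (M, |Y|) <= M + Y^2 / (4 M)]. *)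
Lemma khinchine_large n (u : 'I_n -> R) i :
  \sum_i u i ^+ 2 = 1 -> 21 / 46 <= `|u i| ->
  mean (fun x => `|rademacher_sum u x|) <= 2 * peak + (1 - 2 * peak) * `|u i|.
Proof.
case: n u i => [|n] u i; first by case: i.
move=> u1 M0; pose v j := u (lift i j); pose M := `|u i|.
have M0' : 0 < M by rewrite (lt_le_trans _ M0)//; lra.
have u1' : \sum_j v j ^+ 2 = 1 - M ^+ 2.
  by rewrite real_normK ?num_real// -u1 [in RHS](bigD1_ord i)//= addrAC subrr add0r.
rewrite (mean_rademacher_sum i u Num.norm) -meanD mulrC -meanZ.
apply: (@le_trans _ _ (mean (fun x => M + (4 * M)^-1 *
    (0 + rademacher_sum v x) ^+ 2))).
  apply: ler_mean => x; rewrite add0r -/v; set y := rademacher_sum v x.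
  have -> : 2^-1 * (`|y + u i| + `|y - u i|) = 2^-1 * (`|y + M| + `|y - M|).
    rewrite /M; case: (ger0P (u i)) => // _.
    by rewrite opprK [X in _ * X]addrC.
  rewrite -subr_ge0.
  have -> : M + (4 * M)^-1 * y ^+ 2 - 2^-1 * (`|y + M| + `|y - M|) =
    (4 * M)^-1 * (4 * M ^+ 2 + y ^+ 2 - 2 * M * (`|y + M| + `|y - M|)).
    by field; rewrite gt_eqF.
  rewrite mulr_ge0 ?invr_ge0 ?mulr_ge0 ?(ltW M0')//.
  have := sqr_ge0 (y - 2 * M); have := sqr_ge0 (y + 2 * M); have := sqr_ge0 y.
  by rewrite !expr2; case: (ger0P (y + M)); case: (ger0P (y - M)); nra.
rewrite meanD mean_cst meanZ mean_rademacher_sqr expr0n add0r u1'.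
have M1 : M <= 1.
  have : 0 <= \sum_j v j ^+ 2 by apply: sumr_ge0 => j _; exact: sqr_ge0.
  by rewrite u1' expr2; nra.
have /andP[p1 p2] := peak_bounds R.
(* The threshold [21 / 46] makes the second factor nonnegative: [8 * (67 / 168) - 1 = 46 / 21]. *)
rewrite -/M -subr_ge0 (_ : _ - _ = (1 - M) * (8 * peak * M - 1 - M) / (4 * M)).
  rewrite divr_ge0 ?mulr_ge0 ?(ltW M0') ?subr_ge0//.
  by rewrite -/M in M0; nra.
by field; rewrite gt_eqF.
Qed.

End Lindeberg.

(* A trigonometric majorant of the absolute value *)
Delimit Scope Z_scope with stdZ.

Section Majorant.
Variable R : realType.
Implicit Types (x y : R).

(* With a rational cosine for the grid step, the majorant takes rational values
   on the grid [j / 20], given by a linear recurrence; [freq] is close to 2. *)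
Definition step_angle : R := acos (399 / 401).
Definition freq : R := 20 * step_angle.

Lemma cos_step_angle : cos step_angle = 399 / 401.
Proof. by rewrite acosK// in_itv/=; apply/andP; split; lra. Qed.

Lemma step_angle_ge0 : 0 <= step_angle.
Proof. by rewrite acos_ge0//; apply/andP; split; lra. Qed.

Lemma freq_ge0 : 0 <= freq.
Proof. by rewrite mulr_ge0 ?step_angle_ge0. Qed.

Lemma freq_le2 : freq <= 2.
Proof.
have p := pi_gt157 R.
suff : step_angle <= 1 / 10 by rewrite /freq; lra.
rewrite leNgt; apply/negP => h.
have : cos step_angle < cos (1 / 10).
  rewrite ltr_cos// in_itv/= ?step_angle_ge0 ?acos_lepi//; apply/andP; split; lra.
have tenth : 0 <= 1 / 10 :> R by lra.
rewrite cos_step_angle ltNge => /negP; apply.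
by apply: le_trans (cos_le8 tenth) _; lra.
Qed.

(* The coefficients come from a numerical search; only the cosines have random
   means that need estimating, and these factor over the coordinates. *)
Definition trig_majorant x : R :=
  32 / 59 + 7 / 22 * x ^+ 2 - 3 / 10 * cos (freq * x) -
  1 / 16 * cos (2 * freq * x) - 1 / 45 * cos (3 * freq * x).

Local Notation gap x := (trig_majorant x - x).

Lemma cos3 x : cos (3 * x) = 4 * cos x ^+ 3 - 3 * cos x.
Proof.
rewrite (_ : 3 * x = x *+ 2 + x); last by ring.
rewrite cosD cos_mulr2n sin_mulr2n (_ : cos x * sin x *+ 2 * sin x = 2 * cos x * sin x ^+ 2).
  by rewrite sin2cos2; ring.
by ring.
Qed.

(** The gap at [j / 20] in terms of the cosine [c] of [j * step_angle], by the double and triple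
    angle formulas. *)
Definition gap_poly (j : R) (c : R) : R :=
  32 / 59 + 7 / 22 * (j / 20) ^+ 2 - j / 20 - 3 / 10 * c -
  1 / 16 * (2 * c ^+ 2 - 1) - 1 / 45 * (4 * c ^+ 3 - 3 * c).

Lemma gap_node (j : nat) : gap (j%:R / 20) =
  gap_poly j%:R (cos (j%:R * step_angle)).
Proof.
rewrite /trig_majorant /gap_poly /freq.
rewrite (_ : 20 * _ * _ = j%:R * step_angle); last by field.
rewrite (_ : 2 * (20 * _) * _ = (j%:R * step_angle) *+ 2); last by field.
rewrite (_ : 3 * (20 * _) * _ = 3 * (j%:R * step_angle)); last by field.
by rewrite cos_mulr2n cos3; field.
Qed.

(** Binary integers let [vm_compute] evaluate the check on the grid; this map transfers the outcome
    to [R]. *)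
Definition of_Z (z : Z) : R := (int_of_Z z)%:~R.

Lemma of_ZD a b : of_Z (a + b)%stdZ = of_Z a + of_Z b.
Proof. by rewrite /of_Z [int_of_Z _](rmorphD int_of_Z) rmorphD. Qed.

Lemma of_ZN a : of_Z (- a)%stdZ = - of_Z a.
Proof. by rewrite /of_Z [int_of_Z _](rmorphN int_of_Z) rmorphN. Qed.

Lemma of_ZM a b : of_Z (a * b)%stdZ = of_Z a * of_Z b.
Proof. by rewrite /of_Z [int_of_Z _](rmorphM int_of_Z) rmorphM. Qed.

Lemma of_Z_ge0 a : (0 <=? a)%stdZ -> 0 <= of_Z a.
Proof. by rewrite /of_Z ler0z; case: a. Qed.

Lemma of_Z1 : of_Z 1 = 1. Proof. by []. Qed.

Lemma of_Z_xO p : of_Z (Zpos (xO p)) = 2 * of_Z (Zpos p).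
Proof. by rewrite (_ : Zpos (xO p) = 2 * Zpos p)%stdZ// of_ZM. Qed.

Lemma of_Z_xI p : of_Z (Zpos (xI p)) = 2 * of_Z (Zpos p) + 1.
Proof. by rewrite (_ : Zpos (xI p) = 2 * Zpos p + 1)%stdZ// of_ZD of_ZM. Qed.

Definition of_ZE := (of_Z1, of_Z_xO, of_Z_xI, of_ZD, of_ZN, of_ZM).

(* [p / q] and [p' / (401 q)] are the cosines of the angles [j] and [j + 1]
   times [step_angle]; the test is [gap_poly j (p / q) >= 1 / 880], multiplied
   by [59 * 158400 * q ^ 3]. *)
Fixpoint gap_check (n : nat) (j p p' q : Z) : bool :=
  if n is n.+1 then
    (0 <=? ((32 * 158400) + 59 * (126 * (j * j) + - (7920 * j) + - 180))
         * (q * q * q) +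
       59 * (- (47520 * (p * (q * q))) +
         - (9900 * (2 * (p * p * q) + - (q * q * q))) +
         - (3520 * (4 * (p * p * p) + - (3 * (p * (q * q)))))))%stdZ &&
    gap_check n (j + 1)%stdZ p' (798 * p' + - (160801 * p))%stdZ (401 * q)%stdZ
  else true.

#[local] Arguments Z.add : simpl never.
#[local] Arguments Z.mul : simpl never.
#[local] Arguments Z.opp : simpl never.

Lemma gap_check61 : gap_check 61 0 1 399 1.
Proof. by vm_compute. Qed.

(** The recursion is [cos ((j + 2) t) = 2 cos t cos ((j + 1) t) - cos (j t)] with
    [2 cos t = 798 / 401], cleared of denominators; [160801] is [401 ^ 2]. *)
Lemma gap_checkP n (j : nat) zj p p' q : gap_check n zj p p' q ->
  of_Z zj = j%:R -> 0 < of_Z q -> of_Z p = of_Z q * cos (j%:R * step_angle) ->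
  of_Z p' = 401 * of_Z q * cos (j.+1%:R * step_angle) ->
  forall i, (i < n)%N -> 1 / 880 <= gap ((j + i)%:R / 20).
Proof.
elim: n j zj p p' q => // n IH j zj p p' q /=.
move=> /andP[/of_Z_ge0 h hrec] jE q0 pE pE' [_|i iN].
  rewrite addn0 gap_node -subr_ge0 -(pmulr_rge0 _ (exprn_gt0 3 q0)).
  have D0 : 0 < 59 * (88 * 100 * 18) :> R by lra.
  rewrite -(pmulr_rge0 _ D0).
  move: h; rewrite !of_ZE jE pE /gap_poly.
  set c := cos _; set z := of_Z q.
  by congr (0 <= _); field.
rewrite addnS -addSn; apply: (IH j.+1 _ _ _ _ hrec) => //.
- by rewrite !of_ZE jE natr1.
- by rewrite !of_ZE pmulr_rgt0//; lra.
- by rewrite pE' !of_ZE; ring.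
- rewrite !of_ZE pE' pE.
  have -> : j.+2%:R * step_angle = j.+1%:R * step_angle + step_angle.
    by rewrite -natr1; ring.
  have -> : j%:R * step_angle = j.+1%:R * step_angle - step_angle.
    by rewrite -natr1; ring.
  by rewrite cosB cosD cos_step_angle; field.
Qed.

Lemma gap_nodes i : (i < 61)%N -> 1 / 880 <= gap (i%:R / 20).
Proof.
move=> i61; rewrite -[i]add0n; apply: (gap_checkP gap_check61) => //.
- by rewrite mul0r cos0 !of_ZE; ring.
- by rewrite mul1r cos_step_angle !of_ZE; field.
Qed.

Lemma concave_ge (g g1 g2 : R -> R) (l r x m : R) : l <= x <= r ->
  (forall t : R, is_derive t 1 g (g1 t)) ->
  (forall t : R, is_derive t 1 g1 (g2 t)) ->
  (forall t, g2 t <= 0) -> m <= g l -> m <= g r -> m <= g x.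
Proof.
move=> /andP[lx xr] d1 d2 g20 gl gr.
have mono s t : s <= t -> g1 t <= g1 s.
  move=> st; rewrite -lerN2.
  apply: (@is_derive_homo _ (fun t => - g1 t) (fun t => - g2 t)) => // y _.
  by rewrite oppr_ge0.
have [g1x|g1x] := leP 0 (g1 x).
  apply: le_trans gl _; apply: (@is_derive_homo _ g g1) => // t /andP[_ tx].
  exact: le_trans g1x (mono _ _ tx).
apply: le_trans gr _; rewrite -lerN2.
apply: (@is_derive_homo _ (fun t => - g t) (fun t => - g1 t)) => // t /andP[xt _].
by rewrite oppr_ge0 (le_trans (mono _ _ xt))// ltW.
Qed.

Lemma gap_ge0 x : 0 <= x -> x <= trig_majorant x.
Proof.
move=> x0; rewrite -subr_ge0.
have [x3|x3] := leP 3 x.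
  (* Beyond the grid the quadratic part suffices even if all cosines equal 1. *)
  have := cos_le1 (freq * x); have := cos_le1 (2 * freq * x).
  have := cos_le1 (3 * freq * x).
  by rewrite /trig_majorant !expr2; nra.
pose i := Num.truncn (20 * x).
have /andP[ix xi] : i%:R <= 20 * x < i.+1%:R by apply: truncn_itv; lra.
have i60 : (i < 60)%N by rewrite -(ltr_nat R); lra.
have gi := gap_nodes (leqW i60); have gi1 := @gap_nodes i.+1 i60.
pose l : R := i%:R / 20; pose r : R := i.+1%:R / 20.
have rl : r = l + 1 / 20 by rewrite /r /l -natr1; field.
(* [K] exceeds the second derivative of [gap], so that [g] is concave between
   the grid points and bounded below by its values there. *)
pose K : R := 40 / 11.
pose g t := gap t + K / 2 * (t - l) * (r - t).
have H : 1 / 880 <= g x.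
  apply: (@concave_ge g (fun t => 7 / 11 * t + 3 / 10 * freq * sin (freq * t) +
      1 / 16 * (2 * freq) * sin (2 * freq * t) +
      1 / 45 * (3 * freq) * sin (3 * freq * t) - 1 + K / 2 * (r - t - (t - l)))
    (fun t => 7 / 11 + 3 / 10 * freq ^+ 2 * cos (freq * t) +
      1 / 16 * (2 * freq) ^+ 2 * cos (2 * freq * t) +
      1 / 45 * (3 * freq) ^+ 2 * cos (3 * freq * t) - K) l r).
  - by apply/andP; split; rewrite /l /r; lra.
  - move=> t; rewrite /g /trig_majorant.
    by apply: trigger_derive; rewrite /GRing.scale/=; field.
  - by move=> t; apply: trigger_derive; rewrite /GRing.scale/=; field.
  - move=> t.
    (* With this bound the cosine terms are at most [6 / 5], [1] and [4 / 5], which together with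
       [7 / 11] add up to [K]. *)
    have f2 : freq ^+ 2 <= 4 by have := freq_ge0; have := freq_le2; rewrite expr2; nra.
    have b y : freq ^+ 2 * cos y <= 4.
      by apply: le_trans f2; rewrite ler_piMr ?sqr_ge0 ?cos_le1.
    have := b (freq * t); have := b (2 * freq * t); have := b (3 * freq * t).
    by rewrite /K; lra.
  - by rewrite /g subrr mulr0 mul0r addr0.
  - by rewrite /g subrr mulr0 addr0.
(* The added parabola is at most [K / 2 * (1 / 40) ^+ 2 = 1 / 880], exactly the margin at the
   nodes. *)
move: H; rewrite /g rl /K; have := sqr_ge0 (x - l - 1 / 40).
by rewrite expr2; lra.
Qed.

Lemma norm_le_trig_majorant x : `|x| <= trig_majorant x.
Proof.
case: (ger0P x) => [/gap_ge0//|x0].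
have := @gap_ge0 (- x); rewrite /trig_majorant !mulrN !cosN sqrrN; apply.
by rewrite oppr_ge0 ltW.
Qed.

End Majorant.

(** * Khinchine for entries of middle size, and the three ranges combined *)

Section Khinchine.
Variable R : realType.
Local Notation peak := (peak R).
Local Notation freq := (freq R).
Local Notation trig_majorant := (@trig_majorant R).

Lemma cos_ge6 (x : R) : 0 <= x ->
  1 - x ^+ 2 / 2 + x ^+ 4 / 24 - x ^+ 6 / 720 <= cos x.
Proof.
move=> x0; have [+ _] := cos_sin_taylor 3 x0.
rewrite -signr_odd expr1 !mulN1r lerN2; apply: le_trans.
rewrite /alt_taylor !big_ord_recr big_ord0 /= !taylor_termS taylor_term0.
by rewrite -subr_ge0 (_ : _ - _ = 0); [exact: lexx|field].
Qed.

Lemma sin_le5 (x : R) : 0 <= x -> sin x <= x - x ^+ 3 / 6 + x ^+ 5 / 120.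
Proof.
move=> x0; have [_] := cos_sin_taylor 2 x0.
rewrite -signr_odd expr0 !mul1r => /le_trans; apply.
rewrite /alt_taylor !big_ord_recr big_ord0 /= !taylor_termS taylor_term0.
rewrite !doubleS double0.
by rewrite -subr_ge0 (_ : _ - _ = 0); [exact: lexx|field].
Qed.

(** Serves to turn products of cosines into sums of powers. The quotient of the two sides is
    nondecreasing on the positive side, by Taylor bounds for sine and cosine; [21 / 23] is twice
    [21 / 46], and [freq <= 2]. *)
Lemma cos_ge_exp (x : R) : `|x| <= 21 / 23 ->
  expR (- (x ^+ 2 / 2 + x ^+ 4 / 7)) <= cos x.
Proof.
wlog x0 : x / 0 <= x.
  move=> H xs; case: (leP 0 x) => [x0|/ltW x0]; first exact: H.
  have := H (- x); rewrite oppr_ge0 normrN cosN !sqrrN => /(_ x0 xs).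
  by rewrite (_ : (- x) ^+ 4 = x ^+ 4)//; ring.
rewrite ger0_norm// => xs.
pose g (t : R) := cos t * expR (t ^+ 2 / 2 + t ^+ 4 / 7).
suff : g 0 <= g x.
  rewrite {1}/g cos0 !expr0n /= !mul0r addr0 expR0 mulr1 /g.
  by rewrite expRN -ler_pdivrMr ?expR_gt0// mul1r.
apply: (@is_derive_homo _ g (fun t => expR (t ^+ 2 / 2 + t ^+ 4 / 7) *
  ((t + 4 / 7 * t ^+ 3) * cos t - sin t))) => // t.
  by move=> _; rewrite /g; apply: trigger_derive; rewrite /GRing.scale/=; field.
move=> /andP[t0 tx]; rewrite mulr_ge0 ?expR_ge0// subr_ge0.
apply: (le_trans (sin_le5 t0)).
have q0 : 0 <= t + 4 / 7 * t ^+ 3 by rewrite addr_ge0 ?mulr_ge0 ?exprn_ge0.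
apply: le_trans (ler_wpM2l q0 (cos_ge6 t0)).
rewrite -subr_ge0 (_ : _ - _ = t * t ^+ 2 * (5 / 21 - 53 / 210 * t ^+ 2 +
    113 / 5040 * (t ^+ 2) ^+ 2 - (t ^+ 2) ^+ 3 / 1260)); last by field.
have y0 := sqr_ge0 t.
have y1 : t ^+ 2 <= 21 / 25 by have := le_trans tx xs; rewrite expr2; nra.
move: y0 y1; set y := t ^+ 2 => y0 y1.
have y3 : y ^+ 3 <= 1 by apply: exprn_ile1 => //; lra.
have := sqr_ge0 y => y2.
by apply: mulr_ge0; [exact: mulr_ge0|lra].
Qed.

(** For [eta <= 1] the interval [[- eta, 1]] is closed under multiplication. *)
Lemma prod_geN (eta : R) n (f : 'I_n -> R) : 0 <= eta <= 1 ->
  (forall i, - eta <= f i <= 1) -> - eta <= \prod_i f i.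
Proof.
move=> /andP[e0 e1] H.
suff /andP[] : - eta <= \prod_i f i <= 1 by [].
apply: (big_ind (fun p => - eta <= p <= 1)) => //.
  by rewrite lexx andbT; lra.
move=> p q /andP[p1 p2] /andP[q1 q2].
have [p0|p0] := leP 0 p; have [q0|q0] := leP 0 q; apply/andP; split; nra.
Qed.

Lemma prod_cos_ge0 n (u : 'I_n -> R) t : (forall i, `|t * u i| <= 157 / 100) ->
  0 <= \prod_i cos (t * u i).
Proof.
move=> H; apply: prodr_ge0 => i _; apply: cos_ge0_pihalf.
by have := H i; have := pi_gt157 R; rewrite ler_norml => p /andP[h1 h2];
  apply/andP; split; lra.
Qed.

Lemma prod_cos_geN26 n (u : 'I_n -> R) t : (forall i, `|t * u i| <= 42 / 23) ->
  - (13 / 50) <= \prod_i cos (t * u i).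
Proof.
move=> H; apply: prod_geN => [|i]; first by apply/andP; split; lra.
rewrite cos_le1 andbT -cos_norm.
have c0 : 0 <= 42 / 23 :> R by lra.
apply: (@le_trans _ _ (cos (42 / 23))).
  by apply: le_trans (cos_ge10 c0); lra.
have p := pi_gt157 R.
have Hi := H i; have y0 := normr_ge0 (t * u i).
have my : `|t * u i| \in `[0, pi] by rewrite in_itv/= y0/=; lra.
have mc : 42 / 23 \in `[0, (pi : R)] by rewrite in_itv/=; apply/andP; split; lra.
by rewrite leNgt ltr_cos// -leNgt.
Qed.

Lemma prod_cos_geN1 n (u : 'I_n -> R) t : -1 <= \prod_i cos (t * u i).
Proof.
by apply: prod_geN => [|i]; rewrite ?ler01 ?lexx// cos_geN1 cos_le1.
Qed.

Lemma expRN2_ge : 27 / 200 <= expR (-2) :> R.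
Proof.
have h : 57 / 94 <= expR (- (1 / 2)) :> R.
  have half : 0 <= 1 / 2 :> R by lra.
  have := expRN_taylor 5 half.
  rewrite -signr_odd expr1 !mulN1r lerN2; apply: le_trans.
  rewrite /exp_taylor !big_ord_recr big_ord0 /= !taylor_termS taylor_term0.
  by lra.
rewrite (_ : -2 = 4%:R * (- (1 / 2))); last by field.
rewrite expRM_natl !exprS expr0.
have e0 := expR_ge0 (- (1 / 2) : R).
set e := expR _ in h e0 *.
have h3 : 68 / 185 <= e * e by nra.
rewrite mulr1 mulrA; move: h3; set f := e * e => h3.
by nra.
Qed.

(** By [cos_ge_exp] and [freq <= 2] the product is at least [expR (- 2 - 16 / 7 * M ^+ 2)]; the
    fourth powers are bounded by [M ^+ 2] times squares. *)
Lemma prod_cos_freq n (u : 'I_n -> R) (M : R) : \sum_i u i ^+ 2 = 1 ->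
  (forall i, `|u i| <= M) -> M <= 21 / 46 ->
  27 / 200 * (1 - 16 / 7 * M ^+ 2) <= \prod_i cos (freq * u i).
Proof.
move=> u1 uM M1.
have f0 := freq_ge0 R; have f2 := freq_le2 R.
have small i : `|freq * u i| <= 21 / 23.
  by rewrite normrM ger0_norm//; have := uM i; have := normr_ge0 (u i); nra.
apply: (@le_trans _ _ (\prod_i expR (- ((freq * u i) ^+ 2 / 2 + (freq * u i) ^+ 4 / 7)))).
  rewrite -expR_sum sumrN big_split/= -!mulr_suml.
  have -> : \sum_i (freq * u i) ^+ 2 = freq ^+ 2.
    by under eq_bigr do rewrite exprMn; rewrite -mulr_sumr u1 mulr1.
  have S4 : \sum_i (freq * u i) ^+ 4 <= 16 * M ^+ 2.
    apply: (@le_trans _ _ (\sum_i 16 * M ^+ 2 * u i ^+ 2)).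
      apply: ler_sum => i _.
      have uM2 : u i ^+ 2 <= M ^+ 2.
        by rewrite -(real_normK (num_real (u i))) lerXn2r ?nnegrE// (le_trans _ (uM i)).
      have f4 : freq ^+ 2 <= 4 by rewrite expr2; nra.
      rewrite (_ : (freq * u i) ^+ 4 = freq ^+ 2 * freq ^+ 2 * (u i ^+ 2 * u i ^+ 2)); last by ring.
      rewrite -[leRHS]mulrA; apply: ler_pM.
      - exact: mulr_ge0 (sqr_ge0 _) (sqr_ge0 _).
      - exact: mulr_ge0 (sqr_ge0 _) (sqr_ge0 _).
      - by rewrite (_ : 16 = 4 * 4); [rewrite ler_pM ?sqr_ge0|ring].
      - by rewrite ler_wpM2r ?sqr_ge0.
    by rewrite -mulr_sumr u1 mulr1.
  apply: (@le_trans _ _ (expR (-2) * expR (- (16 / 7 * M ^+ 2)))).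
    have M16 := expR_ge1Dx (- (16 / 7 * M ^+ 2)).
    have e2 := expRN2_ge.
    have [s|s] := leP 0 (1 - 16 / 7 * M ^+ 2).
      by apply: ler_pM; [lra|exact: s|exact: e2|lra].
    by apply: (@le_trans _ _ 0); [lra|exact: mulr_ge0 (expR_ge0 _) (expR_ge0 _)].
  rewrite -expRD ler_expR.
  have f4 : freq ^+ 2 <= 4 by rewrite expr2; nra.
  by lra.
apply: ler_prod => i _; rewrite expR_ge0/=; exact: cos_ge_exp.
Qed.

Lemma mean_trig_majorant n (u : 'I_n -> R) : \sum_i u i ^+ 2 = 1 ->
  mean (fun x => trig_majorant (rademacher_sum u x)) =
  32 / 59 + 7 / 22 - 3 / 10 * \prod_i cos (freq * u i) -
  1 / 16 * \prod_i cos (2 * freq * u i) -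
  1 / 45 * \prod_i cos (3 * freq * u i).
Proof.
move=> u1.
have C t : mean (fun x => cos (t * rademacher_sum u x)) = \prod_i cos (t * u i).
  have := mean_rademacher_cos u t 0; rewrite cos0 mul1r => <-.
  by apply: eq_mean => x; rewrite add0r.
have S : mean (fun x => rademacher_sum u x ^+ 2) = 1.
  have := mean_rademacher_sqr u 0; rewrite expr0n add0r u1 => <-.
  by apply: eq_mean => x; rewrite add0r.
by rewrite /trig_majorant !meanB meanD mean_cst !meanZ !C S mulr1.
Qed.

Lemma concave_quadratic_ge0 (a b c lo hi x : R) : 0 <= c -> lo <= x <= hi ->
  0 <= a + b * lo - c * lo ^+ 2 -> 0 <= a + b * hi - c * hi ^+ 2 ->
  0 <= a + b * x - c * x ^+ 2.
Proof.
move=> c0 /andP[lx xh] hl hh.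
have [lh|lh] := leP hi lo; first by have -> : x = lo by lra.
rewrite -(pmulr_lge0 _ (_ : 0 < hi - lo)) ?subr_gt0//.
rewrite [X in 0 <= X](_ : _ = (a + b * lo - c * lo ^+ 2) * (hi - x) +
  (a + b * hi - c * hi ^+ 2) * (x - lo) + c * (hi - x) * (x - lo) * (hi - lo)).
  have x0 : 0 <= x - lo by rewrite subr_ge0.
  have h0 : 0 <= hi - x by rewrite subr_ge0.
  have d0 : 0 <= hi - lo by rewrite subr_ge0 ltW.
  by rewrite addr_ge0 ?addr_ge0 ?mulr_ge0.
by ring.
Qed.

(** Once the bounds for [k], [P1] and the other products are inserted, the slack is a concave
    quadratic in [M], so the two ends suffice. Its coefficients are [17 / 84 = 1 - 67 / 84],
    [81 / 2000 = 3 / 10 * (27 / 200)] and [81 / 875 = 81 / 2000 * (16 / 7)]. *)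
Lemma mid_numerics (k M P1 P2 P3 e lo hi : R) : lo <= M <= hi ->
  67 / 168 < k -> M <= 21 / 46 ->
  27 / 200 * (1 - 16 / 7 * M ^+ 2) <= P1 ->
  - e <= 1 / 16 * P2 + 1 / 45 * P3 ->
  0 <= 67 / 84 - 32 / 59 - 7 / 22 - e + 81 / 2000 + 17 / 84 * lo -
    81 / 875 * lo ^+ 2 ->
  0 <= 67 / 84 - 32 / 59 - 7 / 22 - e + 81 / 2000 + 17 / 84 * hi -
    81 / 875 * hi ^+ 2 ->
  32 / 59 + 7 / 22 - 3 / 10 * P1 - 1 / 16 * P2 - 1 / 45 * P3 <=
    2 * k + (1 - 2 * k) * M.
Proof.
move=> lMh k1 M1 p1 p23 hlo hhi.
have kM : 0 <= (k - 67 / 168) * (1 - M).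
  by apply: mulr_ge0; clear -k1 M1; lra.
have c0 : 0 <= 81 / 875 :> R by clear; lra.
have := concave_quadratic_ge0 c0 lMh hlo hhi.
by lra.
Qed.

Lemma khinchine_mid n (u : 'I_n -> R) (M : R) :
  \sum_i u i ^+ 2 = 1 -> (forall i, `|u i| <= M) -> 1 / 8 <= M <= 21 / 46 ->
  mean (fun x => `|rademacher_sum u x|) <= 2 * peak + (1 - 2 * peak) * M.
Proof.
move=> u1 uM /andP[M8 M4].
apply: le_trans (ler_mean (fun x => norm_le_trig_majorant _)) _.
rewrite mean_trig_majorant//.
have p1 := prod_cos_freq u1 uM M4.
have /andP[k1 _] := peak_bounds R.
have f0 := freq_ge0 R; have f2 := freq_le2 R.
have tu (c B : R) : 0 <= c -> c * 2 * M <= B -> forall i, `|c * freq * u i| <= B.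
  move=> c0 cB i; rewrite normrM (ger0_norm (mulr_ge0 c0 f0)).
  apply: le_trans cB; rewrite -(mulrA c freq) -(mulrA c 2); apply: ler_wpM2l => //.
  exact: ler_pM f0 (normr_ge0 _) f2 (uM i).
have p3 := prod_cos_geN1 u (3 * freq).
(* Up to [13 / 50] the angles [3 * freq * u i] stay within [pi / 2], so both higher products are
   nonnegative; up to [39 / 100] this holds for [2 * freq * u i]; beyond, both products may be
   negative. *)
have [M26|M26] := leP M (13 / 50).
  have p2 : 0 <= \prod_i cos (2 * freq * u i).
    by apply/prod_cos_ge0/tu => //; clear -M26; lra.
  have {}p3 : 0 <= \prod_i cos (3 * freq * u i).
    by apply/prod_cos_ge0/tu => //; clear -M26; lra.
  apply: (@mid_numerics _ _ _ _ _ 0 (1 / 8) (13 / 50) _ k1 M4 p1).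
  - by rewrite M8.
  - by clear -p2 p3; lra.
  - by clear; lra.
  - by clear; lra.
have [M39|M39] := leP M (39 / 100).
  have p2 : 0 <= \prod_i cos (2 * freq * u i).
    by apply/prod_cos_ge0/tu => //; clear -M39; lra.
  apply: (@mid_numerics _ _ _ _ _ (1 / 45) (13 / 50) (39 / 100) _ k1 M4 p1).
  - by rewrite (ltW M26).
  - by clear -p2 p3; lra.
  - by clear; lra.
  - by clear; lra.
have p2 : - (13 / 50) <= \prod_i cos (2 * freq * u i).
  by apply/prod_cos_geN26/tu => //; clear -M4; lra.
apply: (@mid_numerics _ _ _ _ _ (1 / 45 + 13 / 800) (39 / 100) (21 / 46) _ k1 M4 p1).
- by rewrite (ltW M39).
- by clear -p2 p3; lra.
- by clear; lra.
- by clear; lra.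
Qed.

Lemma khinchine n (u : 'I_n -> R) i :
  \sum_j u j ^+ 2 = 1 -> (forall j, `|u j| <= `|u i|) ->
  mean (fun x => `|rademacher_sum u x|) <= 2 * peak + (1 - 2 * peak) * `|u i|.
Proof.
move=> u1 uM.
have M0 : 0 < `|u i|.
  rewrite lt_neqAle normr_ge0 andbT; apply/eqP => h.
  move: u1; rewrite big1 => [/eqP|j _]; first by rewrite eq_sym oner_eq0.
  have : `|u j| <= 0 by rewrite h.
  by rewrite normr_le0 => /eqP ->; rewrite expr0n.
have [M8|M8] := leP `|u i| (1 / 8); first exact: khinchine_small.
have [M4|M4] := leP (21 / 46) `|u i|; first exact: khinchine_large.
by apply: khinchine_mid => //; rewrite !ltW.
Qed.

End Khinchine.

(** * The scaled profile *)

Section Scale.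
Variable R : realType.
Implicit Types (x y z t v w : R).
Local Notation phi := (@gauss_pdf R).
Local Notation Phi := (@gauss_cdf R).
Local Notation q := (@gauss_quantile R).
Local Notation peak := (peak R).

(** The function [phi y + y * Phi y] is nonnegative with positive derivative [Phi y], so comparing
    with [z - 1] makes the inequality strict. *)
Lemma mills_gt z : - z * Phi z < phi z.
Proof.
have weak y : - y * Phi y <= phi y.
  have [y0|y0] := leP 0 y.
    apply: (@le_trans _ _ 0); last exact/ltW/gauss_pdf_gt0.
    by rewrite mulNr oppr_le0 mulr_ge0// ltW// gauss_cdf_gt0.
  have := @gauss_mills R (- y); rewrite oppr_gt0 gauss_cdfN gauss_pdfN opprB.
  by rewrite addrCA subrr addr0; exact.
rewrite -subr_gt0; pose f y := phi y - - y * Phi y.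
rewrite -/(f z); apply: (@le_lt_trans _ _ (f (z - 1))).
  by rewrite subr_ge0.
apply: (@is_derive_homo_lt _ f Phi) => [|y _|y _]; first by rewrite ltrBlDr ltrDl.
  by rewrite /f; apply: trigger_derive; rewrite /GRing.scale/=; ring.
exact: gauss_cdf_gt0.
Qed.

(** If [z] is the quantile of [T0 / w], the equation defining [w] reads
    [mills z = sqrt (T0 / 2) / T0]; strict monotonicity of [mills] then gives uniqueness. *)
Definition mills z : R := phi z / Phi z.

Lemma is_derive_mills z :
  is_derive z 1 mills (- (phi z * (phi z - - z * Phi z) / Phi z ^+ 2)).
Proof.
have P0 : Phi z != 0 by rewrite gt_eqF ?gauss_cdf_gt0.
have dv : is_derive z 1 (fun y => (Phi y)^-1) (- Phi z ^- 2 *: phi z).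
  exact: is_deriveV.
by rewrite /mills; apply: trigger_derive; rewrite /GRing.scale/=; field.
Qed.

Lemma mills_decr y z : y < z -> mills z < mills y.
Proof.
move=> yz; rewrite -ltrN2.
apply: (@is_derive_homo_lt _ (fun t => - mills t) (fun t =>
  phi t * (phi t - - t * Phi t) / Phi t ^+ 2) _ _ yz) => t _.
  have d := is_derive_mills t.
  by apply: (is_derive_eq (is_deriveN d)); rewrite opprK.
by rewrite divr_gt0 ?mulr_gt0 ?exprn_gt0 ?subr_gt0 ?mills_gt ?gauss_pdf_gt0
  ?gauss_cdf_gt0.
Qed.

Lemma gauss_cdf_tail x n : 0 <= x -> odd n = false ->
  1 / 2 - peak * gauss_taylor n.+1 x <= Phi (- x).
Proof.
move=> x0 on; have := gauss_cdf_taylor n x0.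
by rewrite -signr_odd on expr0 !mul1r gauss_cdfN; lra.
Qed.

Lemma gauss_cdf_tail_le x n : 0 <= x -> odd n ->
  Phi (- x) <= 1 / 2 - peak * gauss_taylor n.+1 x.
Proof.
move=> x0 on; have := gauss_cdf_taylor n x0.
by rewrite -signr_odd on expr1 !mulN1r gauss_cdfN; lra.
Qed.

(** Yields [w >= 51 / 38], because [T0 / w = Phi z] with [z <= - (101 / 100)]. *)
Lemma gauss_cdf_101 : Phi (- (101 / 100)) <= 21 / 100 * 38 / 51.
Proof.
have z0 : 0 <= 101 / 100 :> R by lra.
have /andP[p1 p2] := peak_bounds R.
apply: le_trans (@gauss_cdf_tail_le _ 5 z0 isT) _.
have : 56 / 65 <= gauss_taylor 6 (101 / 100 : R).
  rewrite /gauss_taylor !big_ord_recr big_ord0 /= !doubleS double0 !factS fact0.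
  by clear; lra.
move: (gauss_taylor _ _) => g hg; clear -p1 hg.
have : 0 <= (peak - 67 / 168) * (g - 56 / 65) by apply: mulr_ge0; lra.
by lra.
Qed.

(** Places the root [z] of [mills z = sqrt (T0 / 2) / T0] below [- (101 / 100)], as the right side
    is at least [20 / 13]. *)
Lemma mills_101 : mills (- (101 / 100)) <= 20 / 13.
Proof.
have z0 : 0 <= 101 / 100 :> R by lra.
have /andP[p1 p2] := peak_bounds R.
rewrite /mills ler_pdivrMr ?gauss_cdf_gt0//.
have h := @gauss_cdf_tail (101 / 100) 4 z0 erefl.
have : gauss_taylor 5 (101 / 100 : R) <= 431 / 500.
  rewrite /gauss_taylor !big_ord_recr big_ord0 /= !doubleS double0 !factS fact0.
  by clear; lra.
have : expR (- ((101 / 100) ^+ 2 / 2)) <= 110 / 183 :> R.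
  have y0 : 0 <= (101 / 100) ^+ 2 / 2 :> R by rewrite divr_ge0// sqr_ge0.
  have := expRN_taylor 4 y0; rewrite -signr_odd expr0 !mul1r => /le_trans; apply.
  rewrite /exp_taylor !big_ord_recr big_ord0 /= !taylor_termS taylor_term0.
  by clear; lra.
rewrite gauss_pdfN gauss_pdfE; move: h.
move: (gauss_taylor _ _) (expR _) (Phi _) => g e P h he hg.
have p0 := peak_gt0 R.
have : 0 <= peak * (110 / 183 - e) by apply: mulr_ge0; [exact: ltW|rewrite subr_ge0].
have : 0 <= peak * (431 / 500 - g) by apply: mulr_ge0; [exact: ltW|rewrite subr_ge0].
by clear -h p2; lra.
Qed.

Lemma gauss_pdf_611 : 67 / 195 <= phi (6 / 11).
Proof.
have /andP[p1 _] := peak_bounds R; rewrite gauss_pdfE.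
have : 56 / 65 <= expR (- ((6 / 11) ^+ 2 / 2)) :> R.
  have y0 : 0 <= (6 / 11) ^+ 2 / 2 :> R by rewrite divr_ge0// sqr_ge0.
  have := expRN_taylor 3 y0; rewrite -signr_odd expr1 !mulN1r lerN2; apply: le_trans.
  rewrite /exp_taylor !big_ord_recr big_ord0 /= !taylor_termS taylor_term0.
  by clear; lra.
move: (expR _) => e he; clear -p1 he.
have : 0 <= (peak - 67 / 168) * (e - 56 / 65) by apply: mulr_ge0; lra.
by lra.
Qed.

Lemma gauss_cdf_1225 : 21 / 50 * 38 / 51 <= Phi (- (12 / 25)) <= 6 / 19.
Proof.
have z0 : 0 <= 12 / 25 :> R by lra.
have /andP[p1 p2] := peak_bounds R; apply/andP; split.
  apply: le_trans (@gauss_cdf_tail (12 / 25) 2 z0 erefl).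
  have : gauss_taylor 3 (12 / 25 : R) <= 61 / 131.
    rewrite /gauss_taylor !big_ord_recr big_ord0 /= !doubleS double0 !factS fact0.
    by clear; lra.
  move: (gauss_taylor _ _) => g hg.
  have : 0 <= peak * (61 / 131 - g).
    by apply: mulr_ge0; [exact/ltW/peak_gt0|rewrite subr_ge0].
  by clear -p2; lra.
apply: le_trans (@gauss_cdf_tail_le _ 3 z0 isT) _.
have : 61 / 132 <= gauss_taylor 4 (12 / 25 : R).
  rewrite /gauss_taylor !big_ord_recr big_ord0 /= !doubleS double0 !factS fact0.
  by clear; lra.
move: (gauss_taylor _ _) => g hg; clear -p1 hg.
have : 0 <= (peak - 67 / 168) * (g - 61 / 132) by apply: mulr_ge0; lra.
by lra.
Qed.

End Scale.

(** * The choice of [w] and its consequences for [I_w] *)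

Section ScaledProfile.
Variable R : realType.
Implicit Types (a b x y z t v w : R).
Local Notation phi := (@gauss_pdf R).
Local Notation Phi := (@gauss_cdf R).
Local Notation q := (@gauss_quantile R).
Local Notation s := (Num.sqrt (T0 / 2) : R).

Lemma sqr_sqrt_T0 : s ^+ 2 = 21 / 200.
Proof. by rewrite sqr_sqrtr /T0; lra. Qed.

Lemma sqrt_T0_bounds : 21 / 65 <= s <= 21 / 50.
Proof.
have s0 : 0 <= s by exact: sqrtr_ge0.
have s2 := sqr_sqrt_T0.
by apply/andP; split; rewrite -(@ler_pXn2r _ 2) ?nnegrE// ?s2; lra.
Qed.

Lemma mills_root : exists2 z, z <= - (101 / 100) & mills z = s / T0.
Proof.
have /andP[s1 s2] := sqrt_T0_bounds.
have ab : - 2 <= - (101 / 100) :> R by lra.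
have cont : {within `[- 2, - (101 / 100)], continuous (@mills R)}.
  apply: continuous_subspaceT => z.
  exact: is_derive_continuous (is_derive_mills z).
have m2 : 2 < mills (- 2 : R).
  by rewrite /mills ltr_pdivlMr ?gauss_cdf_gt0// -{1}(opprK 2) mills_gt.
have m1 := mills_101 R.
have c1 : 20 / 13 <= s / T0 by rewrite ler_pdivlMr /T0; lra.
have c2 : s / T0 <= 2 by rewrite ler_pdivrMr /T0; lra.
have [] := @IVT _ _ _ _ (s / T0) ab cont.
  rewrite ge_min le_max (le_trans m1 c1) orbT/=.
  by rewrite (le_trans c2 (ltW m2)).
by move=> z; rewrite in_itv/= => /andP[_ z1] mz; exists z.
Qed.

Lemma scaled_profile_rootP v : T0 <= v ->
  (scaled_profile v T0 = s) <-> (exists2 z, v = T0 / Phi z & mills z = s / T0).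
Proof.
have T00 : 0 < T0 :> R by rewrite /T0; lra.
have /andP[s1 _] := sqrt_T0_bounds.
move=> vT; have v0 : 0 < v by exact: lt_le_trans vT.
rewrite /scaled_profile; split=> [E|[z vE mz]].
  have vn : T0 < v.
    rewrite lt_neqAle vT andbT; apply/eqP => vE; move: E.
    by rewrite -vE divff ?gt_eqF// /gauss_profile ltxx andbF mulr0; lra.
  have tv : 0 < T0 / v < 1 by rewrite divr_gt0//= ltr_pdivrMr ?mul1r.
  exists (q (T0 / v)); first by rewrite gauss_quantileK// invf_div mulrC divfK ?gt_eqF.
  move: E; rewrite gauss_profileE// /mills gauss_quantileK// => <-.
  by rewrite invf_div mulrA [phi _ * _]mulrC.
have P0 := gauss_cdf_gt0 z.
have -> : T0 / v = Phi z by rewrite vE invf_div mulrC divfK ?gt_eqF.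
rewrite gauss_profile_cdf vE -mulrA [_^-1 * _]mulrC -/(mills z) mz mulrC divfK//.
by rewrite gt_eqF.
Qed.

Lemma scaled_profile_unique : exists2 w,
  unique (fun v => T0 <= v /\ scaled_profile v T0 = s) w &
  exists z, [/\ z <= - (101 / 100), Phi z = T0 / w & w * phi z = s].
Proof.
have T00 : 0 < T0 :> R by rewrite /T0; lra.
have [z z1 mz] := mills_root; have P0 := gauss_cdf_gt0 z.
have Tw : T0 <= T0 / Phi z.
  by rewrite ler_pdivlMr// ler_piMr ?(ltW T00)// ltW// gauss_cdf_lt1.
exists (T0 / Phi z).
  split=> [|v [Tv /(scaled_profile_rootP Tv)[y -> my]]].
    by split=> //; apply/(scaled_profile_rootP Tw); exists z.
  have [zy|yz|->//] := ltgtP z y.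
    by have := mills_decr zy; rewrite mz my ltxx.
  by have := mills_decr yz; rewrite mz my ltxx.
exists z; split=> //; first by rewrite invf_div mulrC divfK ?gt_eqF.
by rewrite -mulrA [_^-1 * _]mulrC -/(mills z) mz mulrC divfK ?gt_eqF.
Qed.

Section Scale.
Variables w z : R.
Hypothesis z_le : z <= - (101 / 100).
Hypothesis cdf_z : Phi z = T0 / w.
Hypothesis pdf_z : w * phi z = s.

Lemma scale_ge : 51 / 38 <= w.
Proof.
have P : T0 / w <= 21 / 100 * 38 / 51.
  by rewrite -cdf_z; apply: le_trans (gauss_cdf_101 R); rewrite ler_gauss_cdf.
have w0 : 0 < w.
  have := gauss_cdf_gt0 z; rewrite cdf_z pmulr_rgt0 ?invr_gt0// /T0; lra.
by move: P; rewrite ler_pdivrMr// /T0; lra.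
Qed.

Let w_ge := scale_ge.
Let w_gt0 : 0 < w. Proof. by have := w_ge; lra. Qed.
Let w_neq0 : w != 0. Proof. by rewrite gt_eqF. Qed.

Lemma scale_unit_interval y : 0 < y <= 2 * T0 -> 0 < y / w < 1.
Proof.
have := w_ge; rewrite /T0 => w1 /andP[y0 y1].
by rewrite divr_gt0//= ltr_pdivrMr//; lra.
Qed.

Lemma scaled_profileE x : scaled_profile w (w * Phi x) = w * phi x.
Proof. by rewrite /scaled_profile [w * Phi x]mulrC mulfK// gauss_profile_cdf. Qed.

Lemma scaled_profile_two_point a b : 0 < a <= T0 -> 0 <= b <= a ->
  b ^+ 2 + ((scaled_profile w (a + b) + scaled_profile w (a - b)) / 2) ^+ 2
  <= scaled_profile w a ^+ 2.
Proof.
move=> /andP[a0 aT] /andP[b0 ba].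
have T00 : 0 < T0 :> R by rewrite /T0; lra.
have qa : q (a / w) <= - 1.
  rewrite (@le_trans _ _ z)//; last by have := z_le; lra.
  rewrite -ler_gauss_cdf cdf_z gauss_quantileK ?ler_pM2r ?invr_gt0//.
  by apply: scale_unit_interval; rewrite a0/=; lra.
have ab : a / w + b / w <= 1 / 2.
  by rewrite -mulrDl ler_pdivrMr//; have := w_ge; move: aT; rewrite /T0; lra.
have abw : 0 <= b / w <= a / w by rewrite divr_ge0 ?(ltW w_gt0)//= ler_pM2r ?invr_gt0.
have := profile_two_point (divr_gt0 a0 w_gt0) abw ab qa.
rewrite -(ler_pM2l (exprn_gt0 2 w_gt0)) -mulrDl -mulrBl.
rewrite mulrDr -!exprMn mulrC divfK// mulrA mulrDr.
exact.
Qed.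

(** For [t <= -1] the value is at least [w * phi z = sqrt (T0 / 2)]; for larger [t], [u * phi u]
    increases on [[6 / 11, 1]]. *)
Lemma mul_pdf_ge t : z <= t <= - (6 / 11) -> 1 / 4 <= w * (- t * phi t).
Proof.
have /andP[s1 _] := sqrt_T0_bounds.
move=> /andP[zt t1]; have [t2|t2] := leP t (- 1).
  have pz : phi z <= phi t.
    apply: ler_gauss_pdf; have : 0 <= (t - z) * - (t + z) by apply: mulr_ge0; lra.
    by lra.
  have : w * phi z <= w * phi t by rewrite ler_pM2l.
  rewrite pdf_z => st; have p0 := gauss_pdf_gt0 t.
  have : 0 <= (- t - 1) * (w * phi t).
    by rewrite mulr_ge0// ?mulr_ge0 ?(ltW p0) ?(ltW w_gt0)//; lra.
  by lra.
have mono : 6 / 11 * phi (6 / 11) <= - t * phi (- t).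
  apply: (@is_derive_homo _ (fun u => u * phi u) (fun u => phi u * (1 - u ^+ 2))).
  - by lra.
  - by move=> u _; apply: trigger_derive; rewrite /GRing.scale/=; ring.
  - move=> u /andP[u1 u2]; rewrite mulr_ge0// ?(ltW (gauss_pdf_gt0 u))//.
    by rewrite subr_ge0 expr_le1//; lra.
rewrite gauss_pdfN in mono; have p := gauss_pdf_611 R.
have w1 := w_ge.
have : 51 / 38 * (6 / 11 * (67 / 195)) <= w * (- t * phi t).
  by apply: ler_pM => //; apply: le_trans mono; rewrite ler_pM2l; lra.
by lra.
Qed.

(** Equality holds at [t = z] by the choice of [w], and [mul_pdf_ge] makes the derivative of the
    difference nonnegative. *)
Lemma half_cdf_le t : z <= t <= - (6 / 11) -> Phi t / 2 <= w * phi t ^+ 2.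
Proof.
move=> /andP[zt t1]; rewrite -subr_ge0.
have E : w * phi z ^+ 2 - Phi z / 2 = 0.
  have -> : w * phi z ^+ 2 = (w * phi z) ^+ 2 / w by field.
  by rewrite pdf_z sqr_sqrt_T0 cdf_z /T0; field.
rewrite -E; apply: (@is_derive_homo _ (fun u => w * phi u ^+ 2 - Phi u / 2)
  (fun u => 2 * phi u * (w * (- u * phi u) - 1 / 4)) _ _ zt).
  by move=> u _; apply: trigger_derive; rewrite /GRing.scale/=; field.
move=> u /andP[zu ut]; rewrite mulr_ge0 ?mulr_ge0 ?(ltW (gauss_pdf_gt0 u))//.
by rewrite subr_ge0 mul_pdf_ge// zu/=; lra.
Qed.

(** For [y = w * Phi x] the claim is [Phi x / 2 <= w * phi x ^+ 2]. It is [half_cdf_le] up to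
    [x = - (6 / 11)]; the rest of the range ends before [- (12 / 25)], and constant bounds suffice
    there. *)
Lemma half_le_sqr_scaled_profile y : T0 <= y <= 2 * T0 ->
  y / 2 <= scaled_profile w y ^+ 2.
Proof.
have T00 : 0 < T0 :> R by rewrite /T0; lra.
move=> /andP[y1 y2].
have yw : 0 < y / w < 1 by apply: scale_unit_interval; rewrite y2 (lt_le_trans T00).
have [x Px] := gauss_cdf_surj yw.
have -> : y = w * Phi x by rewrite Px mulrC divfK.
rewrite scaled_profileE exprMn expr2 -!mulrA ler_pM2l//.
have zx : z <= x by rewrite -ler_gauss_cdf Px cdf_z ler_pM2r ?invr_gt0.
have /andP[l1 l2] := gauss_cdf_1225 R.
have w1 := w_ge.
have [x1|x1] := leP x (- (6 / 11)); first by rewrite half_cdf_le// zx.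
have x2 : x <= - (12 / 25).
  rewrite -ler_gauss_cdf Px; apply: le_trans l1.
  by rewrite ler_pdivrMr//; move: y2; rewrite /T0; lra.
have p1 : 67 / 195 <= phi x.
  apply: le_trans (gauss_pdf_611 R) _; apply: ler_gauss_pdf.
  have : 0 <= (6 / 11 - x) * (6 / 11 + x) by apply: mulr_ge0; lra.
  by lra.
have p2 : Phi x <= 6 / 19 by apply: le_trans l2; rewrite ler_gauss_cdf.
have : 51 / 38 * (67 / 195) ^+ 2 <= w * phi x ^+ 2.
  by apply: ler_pM; rewrite // ?ler_pXn2r ?nnegrE//; lra.
by lra.
Qed.

End Scale.
End ScaledProfile.

(** * Level-1 weights of Boolean functions *)

Section BooleanFunctions.
Variable R : realType.

(** Minkowski's inequality; the Cauchy-Schwarz part comes from expanding the sum of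
    [(Q * p j - P * q j) ^+ 2], once the cases [P = 0] and [Q = 0] are set apart. *)
Lemma sqrt_sumD_le n (p q : 'I_n -> R) :
  \sum_j (p j + q j) ^+ 2 <=
  (Num.sqrt (\sum_j p j ^+ 2) + Num.sqrt (\sum_j q j ^+ 2)) ^+ 2.
Proof.
have S0 (r : 'I_n -> R) : 0 <= \sum_j r j ^+ 2 by apply: sumr_ge0 => j _; exact: sqr_ge0.
have Z (r : 'I_n -> R) : Num.sqrt (\sum_j r j ^+ 2) = 0 -> r =1 fun=> 0.
  move=> /eqP; rewrite sqrtr_eq0 => r0 j; apply/eqP; rewrite -sqrf_eq0; apply/eqP.
  have {r0} r0 : \sum_j r j ^+ 2 = 0 by apply: le_anti; rewrite r0 S0.
  by have := psumr_eq0P (fun j _ => sqr_ge0 (r j)) r0; exact.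
have := sqrtr_ge0 (\sum_j p j ^+ 2); have := sqr_sqrtr (S0 p).
have := sqrtr_ge0 (\sum_j q j ^+ 2); have := sqr_sqrtr (S0 q).
move: (Z p) (Z q).
set P : R := Num.sqrt (\sum_j p j ^+ 2); set Q : R := Num.sqrt (\sum_j q j ^+ 2).
rewrite le_eqVlt => Zp Zq Q2 /predU1P[Q0|Q0] P2.
  move=> _; rewrite -Q0 addr0 P2 ler_sum// => j _.
  by rewrite (Zq (esym Q0)) addr0.
rewrite le_eqVlt => /predU1P[P0|P0].
  rewrite -P0 add0r Q2 ler_sum// => j _.
  by rewrite (Zp (esym P0)) add0r.
have PQ0 : 0 < P * Q by exact: mulr_gt0.
have E : \sum_j (p j + q j) ^+ 2 = P ^+ 2 + Q ^+ 2 + 2 * \sum_j p j * q j.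
  rewrite P2 Q2 mulr_sumr -!big_split; apply: eq_bigr => j _ /=; ring.
have F : \sum_j (Q * p j - P * q j) ^+ 2 =
    P * Q * (2 * (P * Q) - 2 * \sum_j p j * q j).
  transitivity (Q ^+ 2 * (\sum_j p j ^+ 2) + P ^+ 2 * (\sum_j q j ^+ 2)
      - 2 * (P * Q) * \sum_j p j * q j); last by rewrite -P2 -Q2; ring.
  rewrite !mulr_sumr -sumrN -!big_split; apply: eq_bigr => j _ /=; ring.
have := S0 (fun j => Q * p j - P * q j); rewrite F pmulr_rge0// E.
by lra.
Qed.

Section Fixed.
Variable n : nat.
Implicit Types (f : {ffun cube n -> bool}) (u : 'I_n -> R).
Local Notation mu f := (mean (fun x => (f x)%:R) : R).
Local Notation fourier f := (@fourier1 R _ f).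
Local Notation weight f := (level1_weight f : R).

Definition cube_opp (x : cube n) : cube n := [ffun i => ~~ x i].

Lemma cube_oppK : involutive cube_opp.
Proof. by move=> x; apply/ffunP => i; rewrite !ffunE negbK. Qed.

Lemma coordinate_opp i x : coordinate i (cube_opp x) = - coordinate i x :> R.
Proof. by rewrite /coordinate ffunE signrN. Qed.

Lemma rademacher_sum_opp u x : rademacher_sum u (cube_opp x) = - rademacher_sum u x.
Proof.
by rewrite /rademacher_sum -sumrN; apply: eq_bigr => i _; rewrite coordinate_opp mulrN.
Qed.

Lemma mean_odd (F : cube n -> R) : (forall x, F (cube_opp x) = - F x) -> mean F = 0.
Proof.
move=> Fo; have := mean_reindex F (can_inj cube_oppK).
by rewrite (eq_mean Fo) meanN; lra.
Qed.

Lemma mean_mul_rademacher_sum f u :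
  mean (fun x => (f x)%:R * rademacher_sum u x) = \sum_i u i * fourier f i.
Proof.
rewrite (eq_mean (G := fun x => \sum_i u i * ((f x)%:R * coordinate i x))).
  by rewrite mean_sum; apply: eq_bigr => i _; rewrite meanZ.
by move=> x; rewrite mulr_sumr; apply: eq_bigr => i _; rewrite mulrCA.
Qed.

Lemma level1_weightE f :
  mean (fun x => (f x)%:R * rademacher_sum (fourier f) x) = weight f.
Proof. by rewrite mean_mul_rademacher_sum; apply: eq_bigr => i _; rewrite expr2. Qed.

Lemma level1_weight_ge0 f : 0 <= weight f.
Proof. by apply: sumr_ge0 => i _; exact: sqr_ge0. Qed.

(* Only the odd part of [f] contributes to level 1, and [f x * f (- x) >= 0]
   bounds its squared norm by half the mean. *)
Lemma level1_weight_le_half f : weight f <= mu f / 2.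
Proof.
pose l := rademacher_sum (fourier f); pose g x : R := (f (cube_opp x))%:R.
have mg : mean g = mu f.
  exact: (mean_reindex (fun x => (f x)%:R) (can_inj cube_oppK)).
have mgl : mean (fun x => g x * l x) = - weight f.
  rewrite -level1_weightE -meanN.
  rewrite -[RHS](mean_reindex _ (can_inj cube_oppK)); apply: eq_mean => x.
  by rewrite rademacher_sum_opp mulrN opprK.
have ml : mean (fun x => l x ^+ 2) = weight f.
  have := mean_rademacher_sqr (fourier f) 0; rewrite expr0n add0r => E.
  by rewrite -[RHS]E; apply: eq_mean => x; rewrite add0r.
(* The integrand is [(f - g - 2 l) ^ 2 + 2 f g], since [f] and [g] take values 0 and 1; its mean is
   [2 * mu f - 4 * weight f]. *)
have : 0 <= mean (fun x => (f x)%:R + g x + (- 4) * ((f x)%:R * l x)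
    + 4 * (g x * l x) + 4 * l x ^+ 2).
  apply: mean_ge0 => x; rewrite /g; move: (l x) (f x) (f (cube_opp x)) => t [] [] /=;
    have := sqr_ge0 t; have := sqr_ge0 (1 - 2 * t); have := sqr_ge0 (1 + 2 * t);
    lra.
by rewrite !meanD !meanZ mg mgl ml level1_weightE; lra.
Qed.

Definition compl_ffun f : {ffun cube n -> bool} := [ffun x => ~~ f x].

Lemma mean_compl f : mu (compl_ffun f) = 1 - mu f.
Proof.
rewrite -[X in X - _](@mean_cst R n) -meanB; apply: eq_mean => x.
by rewrite ffunE; case: (f x); rewrite ?subrr ?subr0.
Qed.

Lemma level1_weight_compl f : weight (compl_ffun f) = weight f.
Proof.
apply: eq_bigr => i _; rewrite -[RHS]sqrrN; congr (_ ^+ 2).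
rewrite -[RHS]add0r -(mean_odd (coordinate_opp i)) -meanB; apply: eq_mean => x.
by rewrite ffunE; case: (f x); rewrite ?mul1r ?mul0r ?subrr ?subr0.
Qed.

Lemma norm_fourier1_le f i : `|fourier f i| <= mu f.
Proof.
rewrite ler_norml -meanN; apply/andP; split; apply: ler_mean => x;
  by rewrite /coordinate; case: (f x); case: (x i); rewrite /= ?expr1 ?expr0; lra.
Qed.

Lemma mean_bool_ge0 f : 0 <= mu f.
Proof. by apply: mean_ge0 => x; exact: ler0n. Qed.

End Fixed.

Definition restriction n (f : {ffun cube n.+1 -> bool}) i b : {ffun cube n -> bool} :=
  [ffun x => f (cube_cons i b x)].

Section Restriction.
Variables (n : nat) (f : {ffun cube n.+1 -> bool}) (i : 'I_n.+1).
Local Notation mu f := (mean (fun x => (f x)%:R) : R).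
Local Notation fourier f := (@fourier1 R _ f).
Local Notation weight f := (level1_weight f : R).

Lemma mean_restrictE b : mu (restriction f i b) = mean (fun x => (f (cube_cons i b x))%:R).
Proof. by apply: eq_mean => x; rewrite ffunE. Qed.

Lemma fourier1_restrict : fourier f i =
  (mu (restriction f i false) - mu (restriction f i true)) / 2.
Proof.
rewrite !mean_restrictE -meanN [LHS](mean_cube_cons i); congr ((_ + _) / _).
  by apply: eq_mean => x; rewrite /coordinate cube_cons_i mulr1.
by apply: eq_mean => x; rewrite /coordinate cube_cons_i mulrN1.
Qed.

Lemma mean_restrict0 : mu (restriction f i false) = mu f + fourier f i.
Proof.
rewrite fourier1_restrict [mu f](mean_cube_cons i) -!mean_restrictE; lra.
Qed.

Lemma mean_restrict1 : mu (restriction f i true) = mu f - fourier f i.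
Proof.
rewrite fourier1_restrict [mu f](mean_cube_cons i) -!mean_restrictE; lra.
Qed.

Lemma fourier1_lift j : fourier f (lift i j) =
  (fourier (restriction f i false) j + fourier (restriction f i true) j) / 2.
Proof.
rewrite [LHS](mean_cube_cons i); congr ((_ + _) / _); apply: eq_mean => x;
  by rewrite ffunE /coordinate cube_cons_lift.
Qed.

(** The remaining coefficients are averages of those of the two restrictions, so Minkowski's
    inequality applies. *)
Lemma level1_weight_restrict : weight f <= fourier f i ^+ 2 +
  ((Num.sqrt (weight (restriction f i false)) +
    Num.sqrt (weight (restriction f i true))) / 2) ^+ 2.
Proof.
rewrite {1}/level1_weight (bigD1_ord i)//= lerD2l.
under eq_bigr do rewrite fourier1_lift expr_div_n.
by rewrite -mulr_suml expr_div_n ler_pM2r ?sqrt_sumD_le// invr_gt0 exprn_gt0.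
Qed.

End Restriction.
End BooleanFunctions.

(** * The two upper bounds for the weight of a single function *)

Section Level1Bound.
Variable R : realType.
Implicit Types (a b : R).
Local Notation phi := (@gauss_pdf R).
Local Notation Phi := (@gauss_cdf R).
Local Notation peak := (peak R).
Local Notation mu f := (mean (fun x => (f x)%:R) : R).
Local Notation fourier f := (@fourier1 R _ f).
Local Notation weight f := (level1_weight f : R).

Section Chi.
Variables w z : R.
Hypothesis z_le : z <= - (101 / 100).
Hypothesis cdf_z : Phi z = T0 / w.
Hypothesis pdf_z : w * phi z = Num.sqrt (T0 / 2).
Local Notation J := (scaled_profile w).

Let w_gt0 : 0 < w.
Proof. by have := scale_ge z_le cdf_z; lra. Qed.

Lemma scaled_profile_ge0 a : 0 <= J a.
Proof. by rewrite mulr_ge0 ?gauss_profile_ge0 ?(ltW w_gt0). Qed.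

Lemma level1_weight_le_profile n (f : {ffun cube n -> bool}) :
  mu f <= T0 -> weight f <= J (mu f) ^+ 2.
Proof.
elim: n f => [|n IH] f fT; first by rewrite /level1_weight big_ord0 sqr_ge0.
have := mean_bool_ge0 R f; rewrite le_eqVlt => /predU1P[f0|f0].
  rewrite /level1_weight big1 ?sqr_ge0// => i _; apply/eqP.
  by rewrite sqrf_eq0 -normr_le0 f0 norm_fourier1_le.
pose i : 'I_n.+1 := ord0; pose b := fourier f i.
have bf : `|b| <= mu f by exact: norm_fourier1_le.
have J0 := scaled_profile_ge0.
(* Both restrictions have mean at most [mu f + |b| <= 2 * T0]: the induction hypothesis covers means
   up to [T0], the bound by half the mean the others. *)
have step (g : {ffun cube n -> bool}) : mu g <= 2 * T0 -> Num.sqrt (weight g) <= J (mu g).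
  move=> gT; rewrite -(@ler_pXn2r _ 2) ?nnegrE ?sqrtr_ge0//.
  rewrite sqr_sqrtr ?level1_weight_ge0//.
  have [|g1] := leP (mu g) T0; first exact: IH.
  apply: le_trans (level1_weight_le_half _ _) _.
  by apply: (half_le_sqr_scaled_profile z_le cdf_z pdf_z); rewrite gT ltW.
have f0T : 0 < mu f <= T0 by rewrite f0.
have b0 : 0 <= `|b| <= mu f by rewrite normr_ge0.
apply: le_trans (scaled_profile_two_point z_le cdf_z f0T b0).
have -> : J (mu f + `|b|) + J (mu f - `|b|) = J (mu f + b) + J (mu f - b).
  by case: (ger0P b) => // _; rewrite opprK addrC.
apply: le_trans (level1_weight_restrict _ _ i) _.
rewrite -/b real_normK ?num_real// lerD2l.
have /andP[b1 b2] : - mu f <= b <= mu f by rewrite -ler_norml.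
rewrite ler_pXn2r ?nnegrE ?divr_ge0 ?addr_ge0 ?sqrtr_ge0// ler_pM2r ?invr_gt0//.
rewrite -mean_restrict0 -mean_restrict1; apply: lerD; apply: step.
  by rewrite mean_restrict0 -/b; lra.
by rewrite mean_restrict1 -/b; lra.
Qed.

Lemma level1_weight_le_chi n (f : {ffun cube n -> bool}) :
  weight f <= chi w (mu f).
Proof.
have low (g : {ffun cube n -> bool}) : weight g <= chi_low w (mu g).
  rewrite /chi_low; case: ifP => [|_]; first exact: level1_weight_le_profile.
  exact: level1_weight_le_half.
rewrite /chi; case: ifP => // _.
by rewrite -mean_compl -level1_weight_compl.
Qed.

Lemma level1_weight_le_chi_restrict n (f : {ffun cube n -> bool}) i :
  weight f <= 1 / 4 * (Num.sqrt (chi w (mu f + `|fourier f i|)) +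
    Num.sqrt (chi w (mu f - `|fourier f i|))) ^+ 2 + `|fourier f i| ^+ 2.
Proof.
case: n f i => [|n] f i; first by case: i.
set b := fourier f i.
have -> : Num.sqrt (chi w (mu f + `|b|)) + Num.sqrt (chi w (mu f - `|b|)) =
    Num.sqrt (chi w (mu f + b)) + Num.sqrt (chi w (mu f - b)).
  by case: (ger0P b) => // _; rewrite opprK addrC.
apply: le_trans (level1_weight_restrict _ _ i) _.
rewrite real_normK ?num_real// addrC lerD2r expr_div_n mulrC.
have -> : (2 ^+ 2)^-1 = 1 / 4 :> R by field.
rewrite ler_pM2l; last by lra.
rewrite ler_pXn2r ?nnegrE ?addr_ge0 ?sqrtr_ge0//.
rewrite -mean_restrict0 -mean_restrict1.
by rewrite lerD// ler_wsqrtr// level1_weight_le_chi.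
Qed.

End Chi.

(** Pointwise [f l <= (|l| + l) / 2], and [l] has mean 0. *)
Lemma mean_mul_rademacher_sum_le n (f : {ffun cube n -> bool}) (u : 'I_n -> R) :
  mean (fun x => (f x)%:R * rademacher_sum u x) <=
  mean (fun x => `|rademacher_sum u x|) / 2.
Proof.
have m0 : mean (rademacher_sum u) = 0 by apply: mean_odd => x; exact: rademacher_sum_opp.
have -> : mean (fun x => `|rademacher_sum u x|) / 2 =
    mean (fun x => 1 / 2 * (`|rademacher_sum u x| + rademacher_sum u x)).
  by rewrite meanZ meanD m0; lra.
apply: ler_mean => x; case: (f x) => /=.
  by have := ler_norm (rademacher_sum u x); lra.
by have := ler_norm (- rademacher_sum u x); rewrite normrN; lra.
Qed.

(** Normalising the coefficients by [s], the square root of the weight, Khinchine gives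
    [s ^+ 2 <= peak * s + (1 / 2 - peak) * b]; completing the square yields
    [(2 * s - peak) ^+ 2 <= D]. *)
Lemma level1_weight_le_khinchine n (f : {ffun cube n -> bool}) i :
  (forall j, `|fourier f j| <= `|fourier f i|) ->
  weight f <= 1 / 4 *
    (Num.sqrt (4 * (1 / 2 - peak) * `|fourier f i| + peak ^+ 2) + peak) ^+ 2.
Proof.
move=> fM; set b := `|fourier f i|.
have p0 := peak_gt0 R.
have b0 : 0 <= b by exact: normr_ge0.
have /andP[_ p1] := peak_bounds R.
set D := 4 * (1 / 2 - peak) * b + peak ^+ 2.
have D0 : 0 <= D.
  by rewrite addr_ge0 ?sqr_ge0 ?mulr_ge0//; lra.
pose s : R := Num.sqrt (weight f).
have s2 : s ^+ 2 = weight f by rewrite sqr_sqrtr// level1_weight_ge0.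
have : 0 <= s by exact: sqrtr_ge0.
rewrite le_eqVlt => /predU1P[s0|s0].
  by rewrite -s2 -s0 expr0n /= mulr_ge0 ?sqr_ge0//; lra.
pose u j := s^-1 * fourier f j.
have norm_u j : `|u j| = s^-1 * `|fourier f j|.
  by rewrite normrM gtr0_norm ?invr_gt0.
have u1 : \sum_j u j ^+ 2 = 1.
  under eq_bigr do rewrite exprMn.
  by rewrite -mulr_sumr -/(level1_weight f) -s2 -exprMn mulVf ?gt_eqF// expr1n.
have uM j : `|u j| <= `|u i| by rewrite !norm_u ler_pM2l ?invr_gt0.
have K := khinchine u1 uM.
have := mean_mul_rademacher_sum_le f u; rewrite mean_mul_rademacher_sum.
have -> : \sum_j u j * fourier f j = s.
  under eq_bigr do rewrite -mulrA -expr2.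
  by rewrite -mulr_sumr -/(level1_weight f) -s2 expr2 mulKf ?gt_eqF.
move=> sK; have {K} K : s <= peak + (1 / 2 - peak) * (s^-1 * b).
  by rewrite norm_u -/b in K; lra.
have {}K : s ^+ 2 <= peak * s + (1 / 2 - peak) * b.
  have : s * s <= s * (peak + (1 / 2 - peak) * (s^-1 * b)) by rewrite ler_pM2l.
  rewrite -expr2 => /le_trans; apply; rewrite le_eqVlt; apply/orP; left; apply/eqP.
  by field; rewrite gt_eqF.
have : 2 * s - peak <= Num.sqrt D.
  apply: le_trans (ler_norm _) _; rewrite -sqrtr_sqr ler_wsqrtr// /D.
  by lra.
move=> sD; have -> : weight f = 1 / 4 * (2 * s) ^+ 2 by rewrite -s2; field.
rewrite ler_pM2l; last by lra.
by rewrite ler_pXn2r ?nnegrE ?addr_ge0 ?sqrtr_ge0 ?(ltW p0)//; lra.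
Qed.

End Level1Bound.

(** * Continuity of the bound in [b] *)

Section ContinuousBound.
Variable R : realType.
Variables w z : R.
Hypothesis z_le : z <= - (101 / 100).
Hypothesis cdf_z : @gauss_cdf R z = T0 / w.
Hypothesis profile_T0 : scaled_profile w T0 = Num.sqrt (T0 / 2).

Let w_ge : 51 / 38 <= w.
Proof. exact: scale_ge z_le cdf_z. Qed.

(** A formula without cases, from which continuity follows by composition; the pieces agree at [T0]
    by the choice of [w]. Negative arguments are clipped to 0, where [gauss_profile] has the same
    value 0. *)
Lemma chi_lowE a : chi_low w a =
  scaled_profile w (Num.min (Num.max a 0) T0) ^+ 2 + (Num.max a T0 - T0) / 2.
Proof.
have T00 : 0 < T0 :> R by rewrite /T0; lra.
rewrite /chi_low; case: (leP a T0) => aT.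
  rewrite subrr mul0r addr0 min_l ?ge_max ?aT ?(ltW T00)//.
  case: (leP a 0) => // a0; congr (_ ^+ 2).
  rewrite /scaled_profile mul0r /gauss_profile ltxx/=.
  have := w_ge => w1; rewrite pmulr_lgt0 ?invr_gt0; last by lra.
  by rewrite ltNge a0.
rewrite max_l ?(ltW (lt_trans T00 aT))// min_r ?(ltW aT)// profile_T0.
rewrite sqr_sqrtr; last by lra.
by lra.
Qed.

Lemma chiE a : chi w a = chi_low w (Num.min a (1 - a)).
Proof.
rewrite /chi; case: ifP => a12; first by rewrite min_l//; lra.
by rewrite min_r//; move/negbT: a12; rewrite -ltNge; lra.
Qed.

Lemma continuous_chi_low : continuous (chi_low w : R -> R).
Proof.
have T00 : 0 < T0 :> R by rewrite /T0; lra.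
move=> a.
rewrite (_ : chi_low w = fun a => scaled_profile w (Num.min (Num.max a 0) T0) ^+ 2
    + (Num.max a T0 - T0) / 2); last by apply/funext => b; exact: chi_lowE.
have cmax (t : R) : Num.max b t @[b --> a] --> Num.max a t.
  by apply: (@continuous_max _ _ (fun b => b) (fun=> t)); [exact: cvg_id|exact: cvg_cst].
apply: cvgD; last by apply: cvgMr_tmp; apply: cvgB; [exact: cmax|exact: cvg_cst].
apply: (@cvg_comp _ _ _ _ (fun u : R => u ^+ 2)); last exact: exprn_continuous.
apply: cvgMl_tmp.
have cmin : {for a, continuous (fun b : R => Num.min (Num.max b 0) (T0 : R))}.
  apply: (@continuous_min R _ (fun b : R => Num.max b 0) (fun=> T0)); first exact: cmax.
  exact: cvg_cst.
set g := fun b : R => Num.min (Num.max b 0) T0 / w.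
have cg : {for a, continuous g} by apply: cvgMr_tmp; exact: cmin.
apply: (@continuous_comp _ _ _ g (@gauss_profile R) _ cg).
apply: continuous_gauss_profile; have w1 := w_ge.
rewrite /g divr_ge0 ?le_min ?le_max ?lexx ?orbT/= ?(ltW T00)//=; last by lra.
rewrite ltr_pdivrMr ?mul1r; last by lra.
by rewrite gt_min; apply/orP; right; rewrite /T0; lra.
Qed.

Lemma continuous_chi : continuous (chi w).
Proof.
move=> a; rewrite (_ : chi w = chi_low w \o (id \min (fun a => 1 - a))); last first.
  by apply/funext => b; exact: chiE.
apply: continuous_comp; last exact: continuous_chi_low.
apply: continuous_min; first exact: cvg_id.
by apply: cvgB; [exact: cvg_cst|exact: cvg_id].
Qed.

Lemma continuous_sqrt_chi_comp (g : R -> R) b : {for b, continuous g} ->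
  {for b, continuous (fun c => Num.sqrt (chi w (g c)))}.
Proof.
move=> cg; apply: (@continuous_comp _ _ _ (chi w \o g) (@Num.sqrt R)).
  by apply: continuous_comp => //; exact: continuous_chi.
exact: sqrt_continuous.
Qed.

Lemma continuous_bound (a k l m : R) : continuous (fun b : R =>
  Num.min (1 / 4 * (Num.sqrt (chi w (a + b)) + Num.sqrt (chi w (a - b))) ^+ 2 + b ^+ 2)
          (1 / 4 * (Num.sqrt (k * b + l) + m) ^+ 2)).
Proof.
have csqr (g : R -> R) b : {for b, continuous g} -> {for b, continuous (fun c => g c ^+ 2)}.
  move=> cg; apply: (@continuous_comp _ _ _ g (fun u : R => u ^+ 2)) => //.
  exact: exprn_continuous.
move=> b; apply: (@continuous_min R _ (fun b : R => 1 / 4 *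
  (Num.sqrt (chi w (a + b)) + Num.sqrt (chi w (a - b))) ^+ 2 + b ^+ 2)
  (fun b : R => 1 / 4 * (Num.sqrt (k * b + l) + m) ^+ 2)).
  have cs : {for b, continuous (fun c : R =>
      Num.sqrt (chi w (a + c)) + Num.sqrt (chi w (a - c)))}.
    apply: cvgD.
      apply: (@continuous_sqrt_chi_comp (fun c => a + c)).
      by apply: cvgD; [exact: cvg_cst|exact: cvg_id].
    apply: (@continuous_sqrt_chi_comp (fun c => a - c)).
    by apply: cvgB; [exact: cvg_cst|exact: cvg_id].
  by apply: cvgD; [apply: cvgMl_tmp; exact: csqr cs|exact: exprn_continuous].
have cs : {for b, continuous (fun c : R => Num.sqrt (k * c + l))}.
  apply: (@continuous_comp _ _ _ (fun c : R => k * c + l) (@Num.sqrt R)).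
    by apply: cvgD; [apply: cvgMl_tmp; exact: cvg_id|exact: cvg_cst].
  exact: sqrt_continuous.
have ct : {for b, continuous (fun c : R => Num.sqrt (k * c + l) + m)}.
  by apply: cvgD; [exact: cs|exact: cvg_cst].
by apply: cvgMl_tmp; exact: csqr ct.
Qed.

End ContinuousBound.

(** * The bound on [W] *)

Theorem theorem5 (R : realType) :
  exists w : R,
    unique (fun v : R => T0 <= v /\ scaled_profile v T0 = Num.sqrt (T0 / 2)) w /\
    forall a : R, dyadic a -> 0 <= a <= 1 / 2 ->
      exists2 M : R,
        is_maximum
          [set Num.min
                 (1 / 4 * (Num.sqrt (chi w (a + b)) + Num.sqrt (chi w (a - b))) ^+ 2
                  + b ^+ 2)
                 (1 / 4 * (Num.sqrt (4 * (1 / 2 - 1 / Num.sqrt (2 * pi)) * b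
                                     + 1 / (2 * pi))
                           + 1 / Num.sqrt (2 * pi)) ^+ 2)
          | b in `[0, a]] M
        & W a <= M.
Proof.
have [w wu [z [z_le cdf_z pdf_z]]] := scaled_profile_unique R.
exists w; split=> // a da /andP[a0 a1].
have profile_T0 := wu.1.2.
have cont := @continuous_bound _ _ _ z_le cdf_z profile_T0 a
  (4 * (1 / 2 - 1 / Num.sqrt (2 * pi))) (1 / (2 * pi)) (1 / Num.sqrt (2 * pi)).
set F := (X in continuous X) in cont.
have [b bI bmax] := @EVT_max R F 0 a a0 (continuous_subspaceT cont).
exists (F b).
  split; first by exists b.
  by move=> _ [c cI <-]; exact: bmax.
apply: ge_sup.
  (* The supremum ranges over positive dimensions, hence [n.+1]; the integer [2 ^+ n * a] stays one
     when doubled. *)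
  case: da => n na; exists (Wn n.+1 a); exists n.+1 => //; split=> //.
  by rewrite exprS -mulrA rpredM// natr_int.
(* The default value 0 of the maximum in [Wn] calls for [0 <= F b]. *)
move=> _ [n [n1 _] <-]; apply: bigmax_le.
  by rewrite /F le_min !(sqr_ge0, addr_ge0, mulr_ge0, divr_ge0).
move=> f /eqP fa; case: n n1 f fa => // n _ f fa.
(* The maximum over [b] is compared with its value at the largest coefficient, which lies in
   [[0, a]]; maximality serves the Khinchine bound. *)
have [i _ imax] := @arg_maxP _ _ _ ord0 xpredT (fun i => `|@fourier1 R _ f i|) isT.
pose c : R := `|fourier1 f i|.
have cI : c \in `[0, a] by rewrite in_itv/= normr_ge0 -fa norm_fourier1_le.
apply: le_trans (bmax c cI); rewrite /F le_min; apply/andP; split.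
  by rewrite -fa; exact: level1_weight_le_chi_restrict z_le cdf_z pdf_z _ _ _.
rewrite [1 / (2 * pi)]div1r ![1 / Num.sqrt _]div1r -sqr_peak; apply: level1_weight_le_khinchine => j.
exact: imax.
Qed.
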